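(* Let $k:A\to B$ be a homomorphism of weak Hopf algebras over a field $\mathbb{F}$. Then: (a) there are a (''cokernel'') unital associative algebra $H$ and a birelatively multiplicative map $\pi:B\to H$ such that $\pi\circ k=\epsilon_{A,H}$; (b) $(H,\pi)$ is universal among such pairs: for any unital associative algebra $H'$ and any birelatively multiplicative map $\pi':B\to H'$ with $\pi'\circ k=\epsilon_{A,H'}$, there is a unique unital algebra homomorphism $\gamma:H\to H'$ such that $\gamma\circ\pi=\pi'$; (c) $H$ has a Hopf algebra structure; (d) $\pi$ is a Hopf map (for this Hopf algebra structure); (e) $(H,\pi)$ is also universal among Hopf algebras: for any Hopf algebra $H'$ and any Hopf map $\pi':B\to H'$ with $\pi'\circ k=\epsilon_{A,H'}$, there is a unique Hopf algebra homomorphism $\gamma:H\to H'$ such that $\gamma\circ\pi=\pi'$.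
   Context: Fix a field $\mathbb{F}$. Sweedler notation without summation sign is used: $\Delta(a)=a^{(1)}\otimes a^{(2)}$. A weak Hopf algebra is a unital associative algebra $A$ that is also a coassociative counital coalgebra, with a linear map $S:A\to A$, such that for all $a,b,c\in A$: $\Delta(ab)=\Delta(a)\Delta(b)$; $(\Delta\otimes\mathrm{id})\Delta(1)=(\Delta(1)\otimes 1)(1\otimes\Delta(1))=(1\otimes\Delta(1))(\Delta(1)\otimes 1)$; $\epsilon(abc)=\epsilon(ab^{(1)})\epsilon(b^{(2)}c)=\epsilon(ab^{(2)})\epsilon(b^{(1)}c)$; $a^{(1)}S(a^{(2)})=\epsilon(1^{(1)}a)1^{(2)}$; $S(a^{(1)})a^{(2)}=1^{(1)}\epsilon(a1^{(2)})$; $S(a^{(1)})a^{(2)}S(a^{(3)})=S(a)$. No finite-dimensionality is assumed. A weak Hopf algebra homomorphism is a unital algebra homomorphism that is a counital coalgebra homomorphism and commutes with antipodes. For a weak Hopf algebra $B$ and an associative algebra $C$, a linear map $\pi:B\to C$ is birelatively multiplicative if $\pi(aS(1^{(1)}))\pi(1^{(2)}b)=\pi(ab)=\pi(a1^{(1)})\pi(S(1^{(2)})b)$ for all $a,b\in B$. If $H$ is a Hopf algebra, a Hopf map $\pi:B\to H$ is a birelatively multiplicative map that is a counital coalgebra homomorphism and satisfies $\pi\circ S_B=S_H\circ\pi$. For a unital algebra $C$, $\epsilon_{A,C}:A\to C$ is the map $a\mapsto\epsilon_A(a)1_C$. *)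

(* Defs.v *)
From HB Require Import structures.
From mathcomp Require Import all_boot all_algebra.
From mathcomp Require Import boolp.

Set Implicit Arguments.
Unset Strict Implicit.
Unset Printing Implicit Defensive.

Import GRing.Theory.
Local Open Scope ring_scope.
Local Open Scope quotient_scope.

(* MathComp's [algType] requires [1 != 0]; here, as usual for unital
   associative algebras, the zero algebra is allowed.  The ring operations of a
   [ualgType] are those of MathComp's [pzRingType] (instance just below). *)
HB.mixin Record Lmodule_isUAlgebra (R : pzRingType) A of GRing.Lmodule R A := {
  ualg_one : A;
  ualg_mul : A -> A -> A;
  ualg_mulA : associative ualg_mul;
  ualg_mul1l : left_id ualg_one ualg_mul;
  ualg_mul1r : right_id ualg_one ualg_mul;
  ualg_mulDl : left_distributive ualg_mul +%R;
  ualg_mulDr : right_distributive ualg_mul +%R;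
  ualg_scaleAl : forall (c : R) (x y : A),
    c *: ualg_mul x y = ualg_mul (c *: x) y;
  ualg_scaleAr : forall (c : R) (x y : A),
    c *: ualg_mul x y = ualg_mul x (c *: y)
}.

#[short(type="ualgType")]
HB.structure Definition UAlgebra (R : pzRingType) :=
  {A of GRing.Lmodule R A & Lmodule_isUAlgebra R A}.

HB.instance Definition _ (R : pzRingType) (A : ualgType R) :=
  GRing.Zmodule_isPzRing.Build (UAlgebra.sort A)
    (@ualg_mulA R A) (@ualg_mul1l R A) (@ualg_mul1r R A)
    (@ualg_mulDl R A) (@ualg_mulDr R A).

Section UAlgebraTheory.
Variables (R : pzRingType) (A : ualgType R).
Implicit Types (c : R) (x y : A).

Lemma uscalerAl c x y : c *: (x * y) = (c *: x) * y.
Proof. exact: ualg_scaleAl. Qed.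

Lemma uscalerAr c x y : c *: (x * y) = x * (c *: y).
Proof. exact: ualg_scaleAr. Qed.

End UAlgebraTheory.

(* The list [:: (a1, b1); ...; (an, bn)] stands for the formal sum of
   pure tensors a1 (x) b1 + ... + an (x) bn; [tensor A B] is the quotient of
   these formal sums by the congruence generated by the bilinearity relations.
   Its universal property is [sweedler_tpure], [sweedler_linear] (existence)
   and [tensor_ind] (uniqueness). *)
Inductive tensor_eq (F : fieldType) (A B : lmodType F) :
    seq (A * B) -> seq (A * B) -> Prop :=
  | TE_refl s : tensor_eq s s
  | TE_sym s t : tensor_eq s t -> tensor_eq t s
  | TE_trans s t u : tensor_eq s t -> tensor_eq t u -> tensor_eq s u
  | TE_cat s s' t t' :
      tensor_eq s s' -> tensor_eq t t' -> tensor_eq (s ++ t) (s' ++ t')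
  | TE_catC s t : tensor_eq (s ++ t) (t ++ s)
  | TE_addl a a' b : tensor_eq [:: (a + a', b)] [:: (a, b); (a', b)]
  | TE_addr a b b' : tensor_eq [:: (a, b + b')] [:: (a, b); (a, b')]
  | TE_scale (c : F) a b : tensor_eq [:: (c *: a, b)] [:: (a, c *: b)]
  | TE_zero b : tensor_eq [:: (0, b)] [::].

Section Tensor.
Variables (F : fieldType) (A B : lmodType F).

Definition tensor_eqb (s t : seq (A * B)) : bool := `[< tensor_eq s t >].

Lemma tensor_eqb_refl : reflexive tensor_eqb.
Proof. by move=> s; apply/asboolP; exact: TE_refl. Qed.

Lemma tensor_eqb_sym : symmetric tensor_eqb.
Proof. by move=> s t; apply/asboolP/asboolP; exact: TE_sym. Qed.

Lemma tensor_eqb_trans : transitive tensor_eqb.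
Proof.
by move=> t s u /asboolP st /asboolP tu; apply/asboolP; exact: TE_trans tu.
Qed.

Canonical tensor_equiv :=
  EquivRel tensor_eqb tensor_eqb_refl tensor_eqb_sym tensor_eqb_trans.

Definition tensor := {eq_quot tensor_equiv}.

HB.instance Definition _ := Choice.on tensor.
HB.instance Definition _ := EqQuotient.on tensor.

Implicit Types (s t : seq (A * B)) (x y z : tensor).

Definition tclass s : tensor := \pi_tensor s.

Lemma tclassP s t : tensor_eq s t -> tclass s = tclass t.
Proof. by move=> st; apply/eqmodP/asboolP. Qed.

Lemma tensor_reprP s : tensor_eq (repr (tclass s)) s.
Proof.
by apply/asboolP; rewrite -/(tensor_eqb _ _) -[tensor_eqb]/(tensor_equiv : rel _);
  apply/eqmodP; rewrite reprK.
Qed.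

Lemma tclassK x : tclass (repr x) = x.
Proof. exact: reprK. Qed.

Definition tscale_seq (c : F) s : seq (A * B) := [seq (c *: p.1, p.2) | p <- s].

Definition tensor_add x y : tensor := tclass (repr x ++ repr y).
Definition tensor_zero : tensor := tclass [::].
Definition tensor_scale (c : F) x : tensor := tclass (tscale_seq c (repr x)).
Definition tensor_opp x : tensor := tensor_scale (- 1) x.

Lemma tscale_seq_eq c s t :
  tensor_eq s t -> tensor_eq (tscale_seq c s) (tscale_seq c t).
Proof.
elim=> {s t} [s|s t _ h|s t u _ h1 _ h2|s s' t t' _ h1 _ h2|s t|a a' b|a b b'
  |d a b|b].
- exact: TE_refl.
- exact: TE_sym.
- exact: TE_trans h2.
- by rewrite /tscale_seq !map_cat; exact: TE_cat.
- by rewrite /tscale_seq !map_cat; exact: TE_catC.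
- by rewrite /= scalerDr; exact: TE_addl.
- exact: TE_addr.
- by rewrite /= scalerA mulrC -scalerA; exact: TE_scale.
- by rewrite /= scaler0; exact: TE_zero.
Qed.

Lemma tclassD s t : tensor_add (tclass s) (tclass t) = tclass (s ++ t).
Proof. by apply: tclassP; apply: TE_cat; exact: tensor_reprP. Qed.

Lemma tclassZ c s : tensor_scale c (tclass s) = tclass (tscale_seq c s).
Proof. by apply: tclassP; apply: tscale_seq_eq; exact: tensor_reprP. Qed.

Lemma tensor_addA : associative tensor_add.
Proof.
move=> x y z; rewrite -[x]tclassK -[y]tclassK -[z]tclassK.
by rewrite !tclassD catA.
Qed.

Lemma tensor_addC : commutative tensor_add.
Proof. by move=> x y; apply: tclassP; exact: TE_catC. Qed.

Lemma tensor_add0 : left_id tensor_zero tensor_add.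
Proof. by move=> x; rewrite -[x]tclassK tclassD. Qed.

Lemma tensor_scaleDl x : {morph tensor_scale^~ x : a b / a + b >-> tensor_add a b}.
Proof.
move=> a b; rewrite -[x]tclassK !tclassZ tclassD.
apply: tclassP; elim: (repr x) => [|[u v] s IHs] /=; first exact: TE_refl.
rewrite scalerDl.
apply: TE_trans (TE_cat (TE_addl (a *: u) (b *: u) v) IHs) _ => /=.
apply: (TE_cat (TE_refl [:: (a *: u, v)])).
rewrite -[_ :: _ ++ _]/(([:: (b *: u, v)] ++ _) ++ _).
rewrite -[X in tensor_eq _ X]/(_ ++ [:: (b *: u, v)] ++ _) catA.
exact: TE_cat (TE_catC _ _) (TE_refl _).
Qed.

Lemma tensor_scale1 : left_id 1 tensor_scale.
Proof.
move=> x; rewrite -[x]tclassK tclassZ; congr tclass.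
by rewrite /tscale_seq -[RHS]map_id; apply: eq_map => -[u v]; rewrite /= scale1r.
Qed.

Lemma tensor_scale0 x : tensor_scale 0 x = tensor_zero.
Proof.
rewrite -[x]tclassK tclassZ; apply: tclassP.
elim: (repr x) => [|[u v] s IHs] /=; first exact: TE_refl.
by rewrite scale0r; exact: (TE_cat (TE_zero A v) IHs).
Qed.

Lemma tensor_addN : left_inverse tensor_zero tensor_opp tensor_add.
Proof.
move=> x; rewrite /tensor_opp -{2}[x]tensor_scale1 -tensor_scaleDl.
by rewrite addNr tensor_scale0.
Qed.

HB.instance Definition _ := GRing.isZmodule.Build tensor
  tensor_addA tensor_addC tensor_add0 tensor_addN.

Lemma tensor_scaleA a b x :
  tensor_scale a (tensor_scale b x) = tensor_scale (a * b) x.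
Proof.
rewrite -[x]tclassK !tclassZ /tscale_seq -map_comp; congr tclass.
by apply: eq_map => -[u v] /=; rewrite scalerA.
Qed.

Lemma tensor_scaleDr : right_distributive tensor_scale +%R.
Proof.
move=> a x y; rewrite -[x]tclassK -[y]tclassK.
by rewrite -[_ + _]/(tensor_add _ _) -[RHS]/(tensor_add _ _)
           tclassD !tclassZ tclassD /tscale_seq map_cat.
Qed.

HB.instance Definition _ := GRing.Zmodule_isLmodule.Build F tensor
  tensor_scaleA tensor_scale1 tensor_scaleDr (fun x a b => tensor_scaleDl x a b).

Definition tpure (a : A) (b : B) : tensor := tclass [:: (a, b)].

(* Sweedler notation: the sum of [f a b] over the pairs (a, b) of a chosen
   decomposition of [x] into pure tensors.  By [sweedler_tclass] the value does
   not depend on this choice when [f] is bilinear. *)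
Definition sweedler (V : zmodType) (x : tensor) (f : A -> B -> V) : V :=
  \sum_(p <- repr x) f p.1 p.2.

Lemma tclass_cons p s : tclass (p :: s) = tpure p.1 p.2 + tclass s.
Proof. by case: p => a b; rewrite -[RHS]/(tensor_add _ _) tclassD. Qed.

Lemma tclass_sum s : tclass s = \sum_(p <- s) tpure p.1 p.2.
Proof. by elim: s => [|p s IHs]; rewrite ?big_nil // big_cons tclass_cons IHs. Qed.

Lemma tensor_decomp x : x = sweedler x tpure.
Proof. by rewrite -[LHS]tclassK tclass_sum. Qed.

Lemma tpureDl a a' b : tpure (a + a') b = tpure a b + tpure a' b.
Proof. by rewrite -[RHS]/(tensor_add _ _) tclassD; apply: tclassP; exact: TE_addl. Qed.

Lemma tpureDr a b b' : tpure a (b + b') = tpure a b + tpure a b'.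
Proof. by rewrite -[RHS]/(tensor_add _ _) tclassD; apply: tclassP; exact: TE_addr. Qed.

Lemma tpureZl c a b : tpure (c *: a) b = c *: tpure a b.
Proof. by rewrite -[RHS]/(tensor_scale _ _) tclassZ. Qed.

Lemma tpureZr c a b : tpure a (c *: b) = c *: tpure a b.
Proof. by rewrite -tpureZl; apply: tclassP; apply: TE_sym; exact: TE_scale. Qed.

Lemma tpure_bilinear : bilinear_for *:%R *:%R tpure.
Proof.
by split=> [b|a] c u v /=; rewrite ?tpureDl ?tpureDr ?tpureZl ?tpureZr.
Qed.

Lemma tensor_ind (P : tensor -> Prop) :
  (forall a b, P (tpure a b)) -> (forall x y, P x -> P y -> P (x + y)) ->
  forall x, P x.
Proof.
move=> Ppure PD x; rewrite -[x]tclassK; elim: (repr x) => [|[a b] s IHs].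
  have -> : tclass [::] = tpure 0 0 by apply/tclassP/TE_sym/TE_zero.
  exact: Ppure.
by rewrite tclass_cons; exact: PD.
Qed.

Section UniversalProperty.
Variables (V : lmodType F) (f : A -> B -> V).
Hypothesis f_bilin : bilinear_for *:%R *:%R f.

Lemma bilinDl a a' b : f (a + a') b = f a b + f a' b.
Proof. by have := f_bilin.1 b 1 a a'; rewrite /= !scale1r. Qed.

Lemma bilinDr a b b' : f a (b + b') = f a b + f a b'.
Proof. by have := f_bilin.2 a 1 b b'; rewrite /= !scale1r. Qed.

Lemma bilin0l b : f 0 b = 0.
Proof. by apply: (addrI (f 0 b)); rewrite -bilinDl !addr0. Qed.

Lemma bilin0r a : f a 0 = 0.
Proof. by apply: (addrI (f a 0)); rewrite -bilinDr !addr0. Qed.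

Lemma bilinZl c a b : f (c *: a) b = c *: f a b.
Proof. by have := f_bilin.1 b c a 0; rewrite /= bilin0l !addr0. Qed.

Lemma bilinZr c a b : f a (c *: b) = c *: f a b.
Proof. by have := f_bilin.2 a c b 0; rewrite /= bilin0r !addr0. Qed.

Lemma sweedler_tclass s : sweedler (tclass s) f = \sum_(p <- s) f p.1 p.2.
Proof.
suff sumE t u : tensor_eq t u ->
    \sum_(p <- t) f p.1 p.2 = \sum_(p <- u) f p.1 p.2.
  exact/sumE/tensor_reprP.
elim=> {s t u} //.
- by move=> s t u _ -> _ ->.
- by move=> s s' t t' _ h1 _ h2; rewrite !big_cat h1 h2.
- by move=> s t; rewrite !big_cat /= addrC.
- by move=> a a' b; rewrite !big_cons !big_nil /= bilinDl !addr0.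
- by move=> a b b'; rewrite !big_cons !big_nil /= bilinDr !addr0.
- by move=> c a b; rewrite !big_cons !big_nil /= bilinZl bilinZr.
- by move=> b; rewrite big_cons big_nil /= bilin0l addr0.
Qed.

Lemma sweedler_tpure a b : sweedler (tpure a b) f = f a b.
Proof. by rewrite sweedler_tclass big_seq1. Qed.

Lemma sweedler_linear : linear (fun x => sweedler x f).
Proof.
move=> c x y; rewrite -[x in LHS]tclassK -[y in LHS]tclassK.
rewrite -[_ + _]/(tensor_add (tensor_scale _ _) _) tclassZ tclassD.
rewrite sweedler_tclass big_cat big_map scaler_sumr; congr (_ + _).
by apply: eq_bigr => p _; rewrite bilinZl.
Qed.

Lemma sweedlerD x y : sweedler (x + y) f = sweedler x f + sweedler y f.
Proof. by have := sweedler_linear 1 x y; rewrite !scale1r. Qed.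


Lemma sweedler0 : sweedler 0 f = 0.
Proof. by rewrite -[0]/(tclass [::]) sweedler_tclass big_nil. Qed.

Lemma sweedlerZ c x : sweedler (c *: x) f = c *: sweedler x f.
Proof. by rewrite -[c *: x]addr0 sweedler_linear sweedler0 addr0. Qed.

End UniversalProperty.
End Tensor.

Notation "x \ot y" := (tpure x y)
  (at level 45, left associativity, format "x  \ot  y") : ring_scope.

(* [\sw_(x, y <- t) E] is the expression [E] in Sweedler notation, where
   [x] and [y] stand for the two components of [t]. *)
Notation "\sw_ ( x , y <- t ) E" := (sweedler t (fun x y => E))
  (at level 41, x binder, y binder, E at level 41,
   format "'[' \sw_ ( x ,  y  <-  t ) '/  '  E ']'") : ring_scope.

Definition tmap (F : fieldType) (A B A' B' : lmodType F)
    (f : A -> A') (g : B -> B') (t : tensor A B) : tensor A' B' :=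
  \sw_(x, y <- t) (f x \ot g y).

Definition tassoc (F : fieldType) (A B C : lmodType F)
    (t : tensor (tensor A B) C) : tensor A (tensor B C) :=
  \sw_(u, z <- t) \sw_(x, y <- u) (x \ot (y \ot z)).

Section TensorAlgebra.
Variables (F : fieldType) (A B : ualgType F).
Implicit Types (a c : A) (b d : B) (t u v : tensor A B).

Definition tensor_one : tensor A B := (1 : A) \ot (1 : B).

Definition tensor_mul t u : tensor A B :=
  \sw_(a, b <- t) \sw_(c, d <- u) ((a * c) \ot (b * d)).

Let inner_bilinear a b : bilinear_for *:%R *:%R
  (fun c d => (a * c) \ot (b * d) : tensor A B).
Proof.
by split=> [d|c] k x y /=;
  rewrite !mulrDr -uscalerAr ?tpureDl ?tpureDr ?tpureZl ?tpureZr.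
Qed.

Let outer_bilinear u : bilinear_for *:%R *:%R
  (fun a b => \sw_(c, d <- u) ((a * c) \ot (b * d)) : tensor A B).
Proof.
split=> [b|a] k x y /=; rewrite /sweedler scaler_sumr -big_split;
  apply: eq_bigr => -[c d] _ /=.
- by rewrite mulrDl -uscalerAl tpureDl tpureZl.
- by rewrite mulrDl -uscalerAl tpureDr tpureZr.
Qed.

Lemma tensor_mulDl : left_distributive tensor_mul +%R.
Proof. by move=> t u v; exact: (sweedlerD (outer_bilinear v)). Qed.

Lemma tensor_mulDr : right_distributive tensor_mul +%R.
Proof.
move=> t u v; rewrite /tensor_mul /sweedler -big_split; apply: eq_bigr.
by move=> -[a b] _ /=; exact: (sweedlerD (inner_bilinear a b)).
Qed.

Lemma tensor_mul_pure a b c d :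
  tensor_mul (a \ot b) (c \ot d) = (a * c) \ot (b * d).
Proof.
rewrite /tensor_mul (sweedler_tpure (outer_bilinear _)).
exact: (sweedler_tpure (inner_bilinear a b)).
Qed.

Lemma tensor_mulA : associative tensor_mul.
Proof.
move=> t u v; elim/tensor_ind: t => [a b|t t' IH IH'].
  elim/tensor_ind: u => [c d|u u' IH IH'].
    elim/tensor_ind: v => [x y|v v' IH IH'].
      by rewrite !tensor_mul_pure !mulrA.
    by rewrite !tensor_mulDr IH IH'.
  by rewrite tensor_mulDl !tensor_mulDr tensor_mulDl IH IH'.
by rewrite !tensor_mulDl IH IH'.
Qed.

Lemma tensor_mul1l : left_id tensor_one tensor_mul.
Proof.
move=> t; elim/tensor_ind: t => [a b|t t' IH IH'].
  by rewrite tensor_mul_pure !mul1r.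
by rewrite tensor_mulDr IH IH'.
Qed.

Lemma tensor_mul1r : right_id tensor_one tensor_mul.
Proof.
move=> t; elim/tensor_ind: t => [a b|t t' IH IH'].
  by rewrite tensor_mul_pure !mulr1.
by rewrite tensor_mulDl IH IH'.
Qed.

Lemma tensor_scaleAl (k : F) t u :
  k *: tensor_mul t u = tensor_mul (k *: t) u.
Proof. by rewrite /tensor_mul (sweedlerZ (outer_bilinear u)). Qed.

Lemma tensor_scaleAr (k : F) t u :
  k *: tensor_mul t u = tensor_mul t (k *: u).
Proof.
rewrite /tensor_mul /sweedler scaler_sumr; apply: eq_bigr => -[a b] _ /=.
by symmetry; exact: (sweedlerZ (inner_bilinear a b)).
Qed.

HB.instance Definition _ := Lmodule_isUAlgebra.Build F (tensor A B)
  tensor_mulA tensor_mul1l tensor_mul1r tensor_mulDl tensor_mulDr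
  tensor_scaleAl tensor_scaleAr.

HB.instance Definition _ := GRing.Zmodule_isPzRing.Build (tensor A B)
  tensor_mulA tensor_mul1l tensor_mul1r tensor_mulDl tensor_mulDr.

End TensorAlgebra.

Section HopfStructures.
Variable F : fieldType.

Record hopfData (A : ualgType F) := HopfData {
  comul : {linear A -> tensor A A};
  counit : {scalar A};
  antipode : {linear A -> A}
}.

Record is_coalgebra (A : ualgType F) (D : hopfData A) : Prop := IsCoalgebra {
  coassoc : forall a, tassoc (tmap (comul D) id (comul D a))
                      = tmap id (comul D) (comul D a);
  counit_l : forall a, \sw_(x, y <- comul D a) (counit D x *: y) = a;
  counit_r : forall a, \sw_(x, y <- comul D a) (counit D y *: x) = a
}.

(* The two axioms on [comul D 1] are stated in A (x) (A (x) A), to which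
   (Delta (x) id) Delta(1) and Delta(1) (x) 1 are transported by [tassoc]. *)
Record is_weak_hopf (A : ualgType F) (D : hopfData A) : Prop := IsWeakHopf {
  whopf_coalgebra : is_coalgebra D;
  whopf_comulM : forall a b, comul D (a * b) = comul D a * comul D b;
  whopf_comul1l : tassoc (tmap (comul D) id (comul D 1))
                  = tassoc (comul D 1 \ot (1 : A)) * ((1 : A) \ot comul D 1);
  whopf_comul1r : tassoc (tmap (comul D) id (comul D 1))
                  = ((1 : A) \ot comul D 1) * tassoc (comul D 1 \ot (1 : A));
  whopf_counitMl : forall a b c, counit D (a * b * c)
    = \sw_(x, y <- comul D b) (counit D (a * x) * counit D (y * c));
  whopf_counitMr : forall a b c, counit D (a * b * c)
    = \sw_(x, y <- comul D b) (counit D (a * y) * counit D (x * c));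
  whopf_antipode_r : forall a,
    \sw_(x, y <- comul D a) (x * antipode D y)
    = \sw_(x, y <- comul D 1) (counit D (x * a) *: y);
  whopf_antipode_l : forall a,
    \sw_(x, y <- comul D a) (antipode D x * y)
    = \sw_(x, y <- comul D 1) (counit D (a * y) *: x);
  whopf_antipode : forall a,
    \sw_(u, z <- comul D a) \sw_(x, y <- comul D u)
      (antipode D x * y * antipode D z) = antipode D a
}.

Record is_hopf (A : ualgType F) (D : hopfData A) : Prop := IsHopf {
  hopf_coalgebra : is_coalgebra D;
  hopf_comulM : monoid_morphism (comul D);
  hopf_counitM : monoid_morphism (counit D);
  hopf_antipode_l : forall a,
    \sw_(x, y <- comul D a) (antipode D x * y) = counit D a *: (1 : A);
  hopf_antipode_r : forall a,
    \sw_(x, y <- comul D a) (x * antipode D y) = counit D a *: (1 : A)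
}.

Record is_coalgebra_hom (A B : ualgType F) (DA : hopfData A) (DB : hopfData B)
    (f : A -> B) : Prop := IsCoalgebraHom {
  coalg_hom_comul : forall a, comul DB (f a) = tmap f f (comul DA a);
  coalg_hom_counit : forall a, counit DB (f a) = counit DA a
}.

(* Used both between weak Hopf algebras and between Hopf algebras. *)
Record is_hopf_hom (A B : ualgType F) (DA : hopfData A) (DB : hopfData B)
    (f : {linear A -> B}) : Prop := IsHopfHom {
  hopf_hom_alg : monoid_morphism f;
  hopf_hom_coalg : is_coalgebra_hom DA DB f;
  hopf_hom_antipode : forall a, f (antipode DA a) = antipode DB (f a)
}.

Record birel_multiplicative (B C : ualgType F) (D : hopfData B)
    (p : {linear B -> C}) : Prop := BirelMultiplicative {
  birel_mul_l : forall a b,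
    \sw_(x, y <- comul D 1) (p (a * antipode D x) * p (y * b)) = p (a * b);
  birel_mul_r : forall a b,
    \sw_(x, y <- comul D 1) (p (a * x) * p (antipode D y * b)) = p (a * b)
}.

Record is_hopf_map (B H : ualgType F) (DB : hopfData B) (DH : hopfData H)
    (p : {linear B -> H}) : Prop := IsHopfMap {
  hopf_map_birel : birel_multiplicative DB p;
  hopf_map_coalg : is_coalgebra_hom DB DH p;
  hopf_map_antipode : forall b, p (antipode DB b) = antipode DH (p b)
}.

End HopfStructures.

(* Main.v *)
Require Import Defs.
From HB Require Import structures.
From mathcomp Require Import all_boot all_algebra.
From mathcomp Require Import boolp.
Set Implicit Arguments.
Unset Strict Implicit.
Unset Printing Implicit Defensive.
Import GRing.Theory.
Local Open Scope ring_scope.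

(** The cokernel is found by pure universality, and its Hopf structure by
    checking that three linear maps on [B] are admissible.

    Call a linear map [p : B -> C] into a unital algebra admissible when it is
    birelatively multiplicative and satisfies [p (k a) = eps a *: 1].  Take the
    free unital algebra on the vector space [B] and identify two elements when
    every admissible map sends them to the same value; the quotient [H] with the
    class map [p : B -> H] is the universal admissible pair, because all the
    conditions imposed on [p] are equations between elements of [C]
    ([univ_eq], [cproj_kills]).  This gives (a) and (b).

    The structure maps of [H] are lifts of admissible maps built from those of
    [B]: the counit [B -> F], the comultiplication [(p (x) p) Delta] into
    [H (x) H], and [p S] into the opposite algebra of [H] ([counit_birel],
    [comul_birel], [antipode_birel]).  Admissibility is where the axioms of a
    weak Hopf algebra enter, through the two counital maps
    [t a = a1 S(a2)] and [s a = S(a1) a2]: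
    - [Delta(1)] lies in [im s (x) im t] ([comul1_src], [comul1_tgt]), and the
      comultiplication of a product with an element of [im t] or [im s] touches
      one tensor leg only ([comul_mul_tgt] and its companions);
    - an element of [im s] or [im t] may be moved from one leg of [Delta b] to
      the other at the price of an antipode ([move_src_right],
      [move_tgt_left]), which is exactly what is needed to apply birelative
      multiplicativity in the second leg after it was used in the first;
    - [S] is antimultiplicative and [S(1_2) (x) S(1_1) = 1_1 (x) 1_2]
      ([antipodeM], [comul1_antipode]).

    The coalgebra axioms of [H] compare algebra morphisms that agree on [p B].
    For the antipode axiom, the elements satisfying it are closed under
    products, and on [p b] birelative multiplicativity turns
    [p (S b1) * p b2] into [p (s b)] ([birel_antipode_l]); the latter is
    [eps b *: 1] since [Delta(1)] is the image of [Delta(1)] under [k], and [p]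
    collapses the image of [k] ([kills_src]).

    For (e), the morphism given by (b) is compatible with the Hopf structures
    because both sides of each compatibility are algebra morphisms, into
    [H' (x) H'], [F] or the opposite of [H'], that agree on [p B]; for the
    antipode this uses antimultiplicativity in [H'], which follows from the weak
    case since Hopf algebras are weak Hopf algebras. *)

(** * Multilinear maps *)

Section Multilinear.
Variable F : fieldType.
Implicit Types (U V W X Y : lmodType F) (A : ualgType F).

Definition bilinear_map U V W (f : U -> V -> W) : Prop :=
  (forall y, linear (fun x => f x y)) /\ (forall x, linear (fun y => f x y)).

Definition trilinear_map U V W X (f : U -> V -> W -> X) : Prop :=
  [/\ forall y z, linear (fun x => f x y z),
      forall x z, linear (fun y => f x y z)
    & forall x y, linear (fun z => f x y z)].

Lemma bilinear_mapP U V W (f : U -> V -> W) :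
  bilinear_map f -> bilinear_for *:%R *:%R f.
Proof. by case=> h1 h2; split=> [y|x] c u v; [apply: h1|apply: h2]. Qed.

Lemma linear_sw U V W (t : tensor U V) X (f : X -> U -> V -> W) :
  (forall x y, linear (fun u => f u x y)) ->
  linear (fun u => \sw_(x, y <- t) f u x y).
Proof.
move=> h c u v; rewrite /sweedler scaler_sumr -big_split.
by apply: eq_bigr => p _; rewrite h.
Qed.

Lemma linear_sw_arg U V W X (g : X -> tensor U V) (f : U -> V -> W) :
  bilinear_map f -> linear g -> linear (fun u => \sw_(x, y <- g u) f x y).
Proof.
by move=> /bilinear_mapP hf hg c u v; rewrite hg (sweedler_linear hf).
Qed.

Lemma linear_idfun U : linear (fun u : U => u).
Proof. by []. Qed.

Lemma linear_appl U V X (f : {linear U -> V}) (g : X -> U) :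
  linear g -> linear (fun u => f (g u)).
Proof. by move=> hg c u v; rewrite hg linearP. Qed.

Lemma linear_mulr A X (g : X -> A) a : linear g -> linear (fun u => a * g u).
Proof. by move=> hg c u v; rewrite hg mulrDr uscalerAr. Qed.

Lemma linear_mull A X (g : X -> A) a : linear g -> linear (fun u => g u * a).
Proof. by move=> hg c u v; rewrite hg mulrDl uscalerAl. Qed.

Lemma linear_scaler V X (g : X -> V) a : linear g -> linear (fun u => a *: g u).
Proof. by move=> hg c u v; rewrite hg scalerDr !scalerA mulrC. Qed.

Lemma linear_scalel U V X (e : {scalar U}) (g : X -> U) (w : V) :
  linear g -> linear (fun u => e (g u) *: w).
Proof. by move=> hg c u v; rewrite hg linearP scalerDl scalerA. Qed.

Lemma linear_scalar U X (e : {scalar U}) (g : X -> U) :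
  linear g -> linear (fun u => e (g u) : F^o).
Proof. by move=> hg c u v; rewrite hg linearP. Qed.

Lemma linear_tpurel U V X (g : X -> U) (w : V) :
  linear g -> linear (fun u => g u \ot w).
Proof. by move=> hg c u v; rewrite hg tpureDl tpureZl. Qed.

Lemma linear_tpurer U V X (g : X -> V) (w : U) :
  linear g -> linear (fun u => w \ot g u).
Proof. by move=> hg c u v; rewrite hg tpureDr tpureZr. Qed.

Lemma linear_bil1 U V W X (f : U -> V -> W) (g : X -> U) y :
  bilinear_map f -> linear g -> linear (fun u => f (g u) y).
Proof. by move=> hf hg c u v; rewrite hg hf.1. Qed.

Lemma linear_bil2 U V W X (f : U -> V -> W) (g : X -> V) y :
  bilinear_map f -> linear g -> linear (fun u => f y (g u)).
Proof. by move=> hf hg c u v; rewrite hg hf.2. Qed.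

Lemma linear_tri1 U V W Y X (f : U -> V -> W -> Y) (g : X -> U) y z :
  trilinear_map f -> linear g -> linear (fun u => f (g u) y z).
Proof. by case=> hf _ _ hg c u v; rewrite hg hf. Qed.

Lemma linear_tri2 U V W Y X (f : U -> V -> W -> Y) (g : X -> V) y z :
  trilinear_map f -> linear g -> linear (fun u => f y (g u) z).
Proof. by case=> _ hf _ hg c u v; rewrite hg hf. Qed.

Lemma linear_tri3 U V W Y X (f : U -> V -> W -> Y) (g : X -> W) y z :
  trilinear_map f -> linear g -> linear (fun u => f y z (g u)).
Proof. by case=> _ _ hf hg c u v; rewrite hg hf. Qed.

End Multilinear.

(** Sweedler expressions are meaningful only when the summand is multilinear, so
    almost every rewriting step carries such a side condition.  The tactic
    follows the syntax of the summand; each variable is expected to occur once. *)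
Ltac mlin :=
  lazymatch goal with
  | |- bilinear_map _ => first [assumption | split; intro; mlin]
  | |- trilinear_map _ => first [assumption | split; intros ? ?; mlin]
  | _ => first
    [ assumption
    | apply: linear_idfun
    | match goal with
      | h : linear ?f |- _ =>
          refine (fun c u v => _ : f _ = c *: f _ + f _); solve [apply: h]
      | h : bilinear_map ?f |- _ =>
          first [apply: (linear_bil1 _ h); mlin | apply: (linear_bil2 _ h); mlin]
      | h : trilinear_map ?f |- _ =>
          first [apply: (linear_tri1 _ _ h); mlin | apply: (linear_tri2 _ _ h); mlin
                | apply: (linear_tri3 _ _ h); mlin]
      end
    | apply: linear_mulr; mlin | apply: linear_mull; mlin
    | apply: linear_scaler; mlin | apply: linear_scalel; mlin
    | apply: linear_scalar; mlin
    | apply: linear_tpurel; mlin | apply: linear_tpurer; mlin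
    | apply: linear_sw; intros ? ?; mlin
    | apply: linear_sw_arg; mlin
    | apply: linear_appl; mlin ]
  end.

(** * Sweedler calculus *)

Section Sweedler.
Variable F : fieldType.
Implicit Types (U V W X Y : lmodType F) (A : ualgType F).

Lemma eq_sw U V (W : zmodType) (t : tensor U V) (f g : U -> V -> W) :
  (forall x y, f x y = g x y) -> \sw_(x, y <- t) f x y = \sw_(x, y <- t) g x y.
Proof. by move=> h; apply: eq_bigr => p _; apply: h. Qed.

Lemma exchange_sw U V U' V' (W : zmodType) (t : tensor U V) (t' : tensor U' V')
    (f : U -> V -> U' -> V' -> W) :
  \sw_(x, y <- t) \sw_(x', y' <- t') f x y x' y'
  = \sw_(x', y' <- t') \sw_(x, y <- t) f x y x' y'.
Proof. exact: exchange_big. Qed.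

Lemma linear_map0 U V (g : U -> V) : linear g -> g 0 = 0.
Proof. by move=> hg; have := hg (-1) 0 0; rewrite scaleN1r scaleN1r !addNr. Qed.

Lemma linear_mapZ U V (g : U -> V) c x : linear g -> g (c *: x) = c *: g x.
Proof. by move=> hg; rewrite -[c *: x]addr0 hg linear_map0 // addr0. Qed.

Lemma linear_mapD U V (g : U -> V) x y : linear g -> g (x + y) = g x + g y.
Proof. by move=> hg; rewrite -[x in LHS]scale1r hg scale1r. Qed.

Lemma sw_appl U V W X (t : tensor U V) (f : U -> V -> W) (g : W -> X) :
  linear g -> \sw_(x, y <- t) g (f x y) = g (\sw_(x, y <- t) f x y).
Proof.
move=> hg; rewrite /sweedler; elim: (repr t) => [|p r IH].
  by rewrite !big_nil linear_map0.
by rewrite !big_cons IH linear_mapD.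
Qed.

Lemma sw_pure U V W (f : U -> V -> W) a b :
  bilinear_map f -> \sw_(x, y <- a \ot b) f x y = f a b.
Proof. by move=> /bilinear_mapP hf; rewrite (sweedler_tpure hf). Qed.

(** This is what makes Sweedler notation composable: a sum over a tensor that is
    itself a Sweedler sum is computed by substitution. *)
Lemma sw_tensor U V U' V' W (t : tensor U V) (g : U -> V -> U') (h : U -> V -> V')
    (f : U' -> V' -> W) : bilinear_map f ->
  \sw_(x', y' <- \sw_(x, y <- t) (g x y \ot h x y)) f x' y'
  = \sw_(x, y <- t) f (g x y) (h x y).
Proof.
move=> hf.
rewrite -(sw_appl t (fun x y => g x y \ot h x y)
  (g := fun u => \sw_(x', y' <- u) f x' y')); last by mlin.
by apply: eq_sw => x y; rewrite sw_pure.
Qed.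

Lemma sw_tmap U V U' V' W (t : tensor U V) (g : U -> U') (h : V -> V')
    (f : U' -> V' -> W) : bilinear_map f ->
  \sw_(x, y <- tmap g h t) f x y = \sw_(x, y <- t) f (g x) (h y).
Proof. exact: sw_tensor. Qed.

Lemma sw_sw U V U' V' W (t : tensor U V) (u : U -> V -> tensor U' V')
    (f : U' -> V' -> W) : bilinear_map f ->
  \sw_(x', y' <- \sw_(x, y <- t) u x y) f x' y'
  = \sw_(x, y <- t) \sw_(x', y' <- u x y) f x' y'.
Proof.
move=> hf.
by rewrite -(sw_appl t u (g := fun u => \sw_(x', y' <- u) f x' y')); last by mlin.
Qed.

Lemma sw_tassoc U V W X (t : tensor (tensor U V) W) (f : U -> tensor V W -> X) :
  bilinear_map f ->
  \sw_(x, w <- tassoc t) f x w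
  = \sw_(u, z <- t) \sw_(x, y <- u) f x (y \ot z).
Proof.
by move=> hf; rewrite /tassoc sw_sw //; apply: eq_sw => u z; rewrite sw_tensor.
Qed.

Lemma sw_mul A A' W (t u : tensor A A') (f : A -> A' -> W) : bilinear_map f ->
  \sw_(x, y <- t * u) f x y
  = \sw_(x, y <- t) \sw_(x', y' <- u) f (x * x') (y * y').
Proof.
by move=> hf; rewrite [t * u]/(tensor_mul t u) /tensor_mul sw_sw //;
  apply: eq_sw => x y; rewrite sw_tensor.
Qed.

Lemma mul_sw U V U' V' A (t : tensor U V) (t' : tensor U' V')
    (f : U -> V -> A) (g : U' -> V' -> A) :
  (\sw_(x, y <- t) f x y) * (\sw_(x', y' <- t') g x' y')
  = \sw_(x, y <- t) \sw_(x', y' <- t') (f x y * g x' y').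
Proof.
rewrite -(sw_appl t f (g := fun u : A => u * _)); last by mlin.
apply: eq_sw => x y.
by rewrite -(sw_appl t' g (g := fun u : A => f x y * u)); last by mlin.
Qed.

Lemma mul_tpure A A' (a c : A) (b d : A') :
  (a \ot b) * (c \ot d) = (a * c) \ot (b * d).
Proof. exact: tensor_mul_pure. Qed.

End Sweedler.

(** * Coalgebra axioms in Sweedler form *)

Section Coalgebra.
Variables (F : fieldType) (C : ualgType F) (D : hopfData C) (V : lmodType F).
Hypothesis coalgD : is_coalgebra D.

Lemma sw_coassoc a (f : C -> C -> C -> V) : trilinear_map f ->
  \sw_(u, z <- comul D a) \sw_(x, y <- comul D u) f x y z
  = \sw_(x, w <- comul D a) \sw_(y, z <- comul D w) f x y z.
Proof.
move=> hf.
have := congr1 (fun t => \sw_(x, w <- t) \sw_(y, z <- w) f x y z)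
  (coassoc coalgD a).
rewrite /= sw_tassoc; last by mlin.
rewrite !sw_tmap; [|by mlin|].
  move<-; apply: eq_sw => u z; apply: eq_sw => x y.
  by rewrite sw_pure; last by mlin.
split=> [z|t] /=; mlin.
Qed.

Lemma sw_counitl a (g : C -> V) : linear g ->
  \sw_(x, y <- comul D a) (counit D x *: g y) = g a.
Proof.
move=> hg; rewrite -{2}(counit_l coalgD a) -(sw_appl _ _ hg).
by apply: eq_sw => x y; rewrite linear_mapZ.
Qed.

Lemma sw_counitr a (g : C -> V) : linear g ->
  \sw_(x, y <- comul D a) (counit D y *: g x) = g a.
Proof.
move=> hg; rewrite -{2}(counit_r coalgD a) -(sw_appl _ _ hg).
by apply: eq_sw => x y; rewrite linear_mapZ.
Qed.

End Coalgebra.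

Section CounitalMaps.
Variables (F : fieldType) (B : ualgType F) (D : hopfData B).

(** The target counital map, which equals [a1 S(a2)] in a weak Hopf algebra; its
    mirror image below equals [S(a1) a2]. *)
Definition tgt (a : B) : B := \sw_(x, y <- comul D 1) (counit D (x * a) *: y).
Definition src (a : B) : B := \sw_(x, y <- comul D 1) (counit D (a * y) *: x).

Lemma tgt_linear : linear tgt.
Proof. by rewrite /tgt; mlin. Qed.

Lemma src_linear : linear src.
Proof. by rewrite /src; mlin. Qed.

HB.instance Definition _ := GRing.isLinear.Build F B B *:%R tgt tgt_linear.
HB.instance Definition _ := GRing.isLinear.Build F B B *:%R src src_linear.

End CounitalMaps.

(** * Counital maps and antipode of a weak Hopf algebra *)

Section WeakHopf.
Variables (F : fieldType) (B : ualgType F) (D : hopfData B).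
Hypothesis hB : is_weak_hopf D.
Implicit Types (V : lmodType F) (a b : B).

Local Notation Delta := (comul D).
Local Notation eps := (counit D).
Local Notation S := (antipode D).
Local Notation t := (tgt D).
Local Notation s := (src D).
Let coalgB := whopf_coalgebra hB.

Lemma sw_comulM V a b (f : B -> B -> V) : bilinear_map f ->
  \sw_(x, y <- Delta (a * b)) f x y
  = \sw_(x, y <- Delta a) \sw_(x', y' <- Delta b) f (x * x') (y * y').
Proof. by move=> hf; rewrite (whopf_comulM hB) sw_mul. Qed.

Lemma sw_comulMl1 V a (f : B -> B -> V) : bilinear_map f ->
  \sw_(x, y <- Delta 1) \sw_(x', y' <- Delta a) f (x * x') (y * y')
  = \sw_(x, y <- Delta a) f x y.
Proof. by move=> hf; rewrite -sw_comulM // mul1r. Qed.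

Lemma sw_comulMr1 V a (f : B -> B -> V) : bilinear_map f ->
  \sw_(x, y <- Delta a) \sw_(x', y' <- Delta 1) f (x * x') (y * y')
  = \sw_(x, y <- Delta a) f x y.
Proof. by move=> hf; rewrite -sw_comulM // mulr1. Qed.

Let comul2 V (f : B -> B -> B -> V) : trilinear_map f ->
  \sw_(x, w <- tassoc (tmap Delta id (Delta 1))) \sw_(y, z <- w) f x y z
  = \sw_(x, w <- Delta 1) \sw_(y, z <- Delta w) f x y z.
Proof.
move=> hf; rewrite (coassoc coalgB) sw_tmap //.
split=> [z|x] /=; mlin.
Qed.

(** The threefold coproduct of the unit is [1_1 (x) 1_2 1'_1 (x) 1'_2]; in the
    next lemma the middle product is taken in the opposite order.  Together they
    say that the second leg of one copy of [Delta(1)] commutes with the first leg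
    of another. *)
Lemma comul1l V (f : B -> B -> B -> V) : trilinear_map f ->
  \sw_(x, w <- Delta 1) \sw_(y, z <- Delta w) f x y z
  = \sw_(x, y <- Delta 1) \sw_(y', z <- Delta 1) f x (y * y') z.
Proof.
move=> hf; rewrite -comul2 // (whopf_comul1l hB).
rewrite sw_mul; last by split=> [z|x] /=; mlin.
rewrite sw_tassoc; last first.
  by split=> [z|x] /=; mlin.
rewrite sw_pure; last by split=> [z|x] /=; mlin.
apply: eq_sw => x y.
rewrite sw_pure; last by split=> [z|w] /=; mlin.
rewrite sw_mul; last by split=> [z|w] /=; mlin.
rewrite sw_pure; last by split=> [z|w] /=; mlin.
by apply: eq_sw => y' z; rewrite mulr1 mul1r.
Qed.

Lemma comul1r V (f : B -> B -> B -> V) : trilinear_map f ->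
  \sw_(x, w <- Delta 1) \sw_(y, z <- Delta w) f x y z
  = \sw_(x, y <- Delta 1) \sw_(y', z <- Delta 1) f x (y' * y) z.
Proof.
move=> hf; rewrite -comul2 // (whopf_comul1r hB).
rewrite sw_mul; last by split=> [z|x] /=; mlin.
rewrite sw_pure; last by split=> [z|x] /=; mlin.
rewrite sw_tassoc; last first.
  by split=> [z|x] /=; mlin.
rewrite sw_pure; last by split=> [z|x] /=; mlin.
apply: eq_sw => x y.
rewrite sw_mul; last by split=> [z|w] /=; mlin.
under eq_sw => y' z.
  rewrite sw_pure; last by split=> [u|w] /=; mlin.
  over.
by apply: eq_sw => y' z; rewrite mulr1 mul1r.
Qed.

Lemma tgt_appl V (g : B -> V) a : linear g ->
  g (t a) = \sw_(x, y <- Delta 1) (eps (x * a) *: g y).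
Proof. by move=> hg; rewrite -sw_appl //; apply: eq_sw => x y; rewrite linear_mapZ. Qed.

Lemma src_appl V (g : B -> V) a : linear g ->
  g (s a) = \sw_(x, y <- Delta 1) (eps (a * y) *: g x).
Proof. by move=> hg; rewrite -sw_appl //; apply: eq_sw => x y; rewrite linear_mapZ. Qed.

Lemma counit_mul_tgt a b : eps (a * t b) = eps (a * b).
Proof.
rewrite -[in RHS](mulr1 a) (whopf_counitMr hB).
rewrite (tgt_appl (g := fun u : B => eps (a * u) : F^o)); last by mlin.
by apply: eq_sw => x y; rewrite [LHS]mulrC.
Qed.

Lemma counit_src_mul a b : eps (s a * b) = eps (a * b).
Proof.
rewrite -[in RHS](mulr1 a) (whopf_counitMr hB).
by rewrite (src_appl (g := fun u : B => eps (u * b) : F^o)); last by mlin.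
Qed.

(** Applying the counit to the middle leg of the threefold coproduct of [1] gives
    [1_1 (x) t(1_2)]: the second leg of [Delta(1)] lies in [im t].  The next
    lemma places the first leg in [im s] by the same computation. *)
Lemma comul1_tgt V (f : B -> B -> V) : bilinear_map f ->
  \sw_(x, y <- Delta 1) f x (t y) = \sw_(x, y <- Delta 1) f x y.
Proof.
move=> hf.
transitivity (\sw_(x, y <- Delta 1) \sw_(y', z <- Delta 1) (eps (y' * y) *: f x z)).
  by apply: eq_sw => x y; rewrite tgt_appl; last by mlin.
rewrite -(comul1r (f := fun x y z => eps y *: f x z)); last by mlin.
by apply: eq_sw => x w; rewrite (sw_counitl coalgB); last by mlin.
Qed.

Lemma comul1_src V (f : B -> B -> V) : bilinear_map f ->
  \sw_(x, y <- Delta 1) f (s x) y = \sw_(x, y <- Delta 1) f x y.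
Proof.
move=> hf.
transitivity (\sw_(x, y <- Delta 1) \sw_(u, v <- Delta 1) (eps (u * y) *: f x v)).
  rewrite exchange_sw; apply: eq_sw => x y.
  by rewrite (src_appl (g := fun u : B => f u y)); last by mlin.
rewrite -(comul1r (f := fun x y z => eps y *: f x z)); last by mlin.
by apply: eq_sw => x w; rewrite (sw_counitl coalgB); last by mlin.
Qed.

(** Elements of [im t] are [eps(1_1 a) 1_2], so their coproduct is read off from
    the threefold coproduct of [1].  Its two descriptions give the two sided
    forms [Delta(t a) = t a 1_1 (x) 1_2 = 1_1 t a (x) 1_2], and similarly for
    [im s] with the second leg. *)
Lemma comul_tgt_left V a (f : B -> B -> V) : bilinear_map f ->
  \sw_(x, y <- Delta (t a)) f x y = \sw_(x, y <- Delta 1) f (t a * x) y.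
Proof.
move=> hf.
rewrite (tgt_appl (g := fun u : B => \sw_(x, y <- Delta u) f x y)); last by mlin.
transitivity (\sw_(x, w <- Delta 1) \sw_(y, z <- Delta w) (eps (x * a) *: f y z)).
  by apply: eq_sw => x w; rewrite (sw_appl _ _ (g := fun u => _ *: u)); last by mlin.
rewrite (comul1l (f := fun x y z => eps (x * a) *: f y z)); last by mlin.
rewrite exchange_sw; apply: eq_sw => x y.
by rewrite (tgt_appl (g := fun u : B => f (u * x) y)); last by mlin.
Qed.

Lemma comul_tgt_right V a (f : B -> B -> V) : bilinear_map f ->
  \sw_(x, y <- Delta (t a)) f x y = \sw_(x, y <- Delta 1) f (x * t a) y.
Proof.
move=> hf.
rewrite (tgt_appl (g := fun u : B => \sw_(x, y <- Delta u) f x y)); last by mlin.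
transitivity (\sw_(x, w <- Delta 1) \sw_(y, z <- Delta w) (eps (x * a) *: f y z)).
  by apply: eq_sw => x w; rewrite (sw_appl _ _ (g := fun u => _ *: u)); last by mlin.
rewrite (comul1r (f := fun x y z => eps (x * a) *: f y z)); last by mlin.
rewrite exchange_sw; apply: eq_sw => x y.
by rewrite (tgt_appl (g := fun u : B => f (x * u) y)); last by mlin.
Qed.

Lemma comul_src_right V a (f : B -> B -> V) : bilinear_map f ->
  \sw_(x, y <- Delta (s a)) f x y = \sw_(x, y <- Delta 1) f x (y * s a).
Proof.
move=> hf.
rewrite (src_appl (g := fun u : B => \sw_(x, y <- Delta u) f x y)); last by mlin.
transitivity (\sw_(u, z <- Delta 1) \sw_(x, y <- Delta u) (eps (a * z) *: f x y)).
  by apply: eq_sw => x w; rewrite (sw_appl _ _ (g := fun u => _ *: u)); last by mlin.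
rewrite (sw_coassoc coalgB _ (f := fun x y z => eps (a * z) *: f x y));
  last by mlin.
rewrite (comul1l (f := fun x y z => eps (a * z) *: f x y)); last by mlin.
apply: eq_sw => x y.
by rewrite (src_appl (g := fun u : B => f x (y * u))); last by mlin.
Qed.

Lemma comul_src_left V a (f : B -> B -> V) : bilinear_map f ->
  \sw_(x, y <- Delta (s a)) f x y = \sw_(x, y <- Delta 1) f x (s a * y).
Proof.
move=> hf.
rewrite (src_appl (g := fun u : B => \sw_(x, y <- Delta u) f x y)); last by mlin.
transitivity (\sw_(u, z <- Delta 1) \sw_(x, y <- Delta u) (eps (a * z) *: f x y)).
  by apply: eq_sw => x w; rewrite (sw_appl _ _ (g := fun u => _ *: u)); last by mlin.
rewrite (sw_coassoc coalgB _ (f := fun x y z => eps (a * z) *: f x y));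
  last by mlin.
rewrite (comul1r (f := fun x y z => eps (a * z) *: f x y)); last by mlin.
apply: eq_sw => x y.
by rewrite (src_appl (g := fun u : B => f x (u * y))); last by mlin.
Qed.

(** Since [Delta(b) = Delta(b) Delta(1) = Delta(1) Delta(b)], the one legged form
    of [Delta(t a)] passes to products with any [b]. *)
Lemma comul_mul_tgt V b a (f : B -> B -> V) : bilinear_map f ->
  \sw_(x, y <- Delta (b * t a)) f x y = \sw_(x, y <- Delta b) f (x * t a) y.
Proof.
move=> hf; rewrite sw_comulM //.
rewrite -(sw_comulMr1 b (f := fun x y => f (x * t a) y)); last by mlin.
apply: eq_sw => x y; rewrite comul_tgt_right; last by mlin.
by apply: eq_sw => x' y'; rewrite mulrA.
Qed.

Lemma comul_tgt_mul V b a (f : B -> B -> V) : bilinear_map f ->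
  \sw_(x, y <- Delta (t a * b)) f x y = \sw_(x, y <- Delta b) f (t a * x) y.
Proof.
move=> hf; rewrite sw_comulM //.
rewrite -(sw_comulMl1 b (f := fun x y => f (t a * x) y)); last by mlin.
rewrite (comul_tgt_left a (f := fun x y => \sw_(x', y' <- _) f (x * x') (y * y')));
  last by mlin.
by apply: eq_sw => x y; apply: eq_sw => x' y'; rewrite mulrA.
Qed.

Lemma comul_mul_src V b a (f : B -> B -> V) : bilinear_map f ->
  \sw_(x, y <- Delta (b * s a)) f x y = \sw_(x, y <- Delta b) f x (y * s a).
Proof.
move=> hf; rewrite sw_comulM //.
rewrite -(sw_comulMr1 b (f := fun x y => f x (y * s a))); last by mlin.
apply: eq_sw => x y; rewrite comul_src_right; last by mlin.
by apply: eq_sw => x' y'; rewrite mulrA.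
Qed.

Lemma comul_src_mul V b a (f : B -> B -> V) : bilinear_map f ->
  \sw_(x, y <- Delta (s a * b)) f x y = \sw_(x, y <- Delta b) f x (s a * y).
Proof.
move=> hf; rewrite sw_comulM //.
rewrite -(sw_comulMl1 b (f := fun x y => f x (s a * y))); last by mlin.
rewrite (comul_src_left a (f := fun x y => \sw_(x', y' <- _) f (x * x') (y * y')));
  last by mlin.
by apply: eq_sw => x y; apply: eq_sw => x' y'; rewrite mulrA.
Qed.

(** The images of [t] and [s] commute because the second leg of one copy of
    [Delta(1)] commutes with the first leg of another. *)
Lemma tgt_srcC a b : t a * s b = s b * t a.
Proof.
pose f (x y z : B) := eps (x * a) *: (eps (b * z) *: y).
have hf : trilinear_map f by rewrite /f; mlin.
transitivity (\sw_(x, y <- Delta 1) \sw_(y', z <- Delta 1) f x (y * y') z).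
  rewrite (tgt_appl (g := fun u : B => u * s b)); last by mlin.
  apply: eq_sw => x y.
  rewrite (src_appl (g := fun u => _ *: (y * u))); last by mlin.
  by apply: eq_sw => y' z; rewrite /f scalerA mulrC -scalerA.
rewrite -comul1l // comul1r //.
rewrite (tgt_appl (g := fun u : B => s b * u)); last by mlin.
apply: eq_sw => x y.
rewrite (src_appl (g := fun u => _ *: (u * y))); last by mlin.
by apply: eq_sw => y' z; rewrite /f scalerA mulrC -scalerA.
Qed.

Lemma conv_id_antipode a : \sw_(x, y <- Delta a) (x * S y) = t a.
Proof. exact: (whopf_antipode_r hB). Qed.

Lemma conv_antipode_id a : \sw_(x, y <- Delta a) (S x * y) = s a.
Proof. exact: (whopf_antipode_l hB). Qed.

Lemma tgt_mul_tgt a b : t (a * t b) = t (a * b).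
Proof.
by rewrite /tgt; apply: eq_sw => x y; rewrite mulrA counit_mul_tgt mulrA.
Qed.

Lemma src_src_mul a b : s (s a * b) = s (a * b).
Proof.
by rewrite /src; apply: eq_sw => x y; rewrite -mulrA counit_src_mul mulrA.
Qed.

(** Read [t] as [x1 S(x2)]: as [t a] only multiplies the first leg of
    [Delta(b)], it can be pulled out. *)
Lemma tgt_tgt_mul a b : t (t a * b) = t a * t b.
Proof.
rewrite -conv_id_antipode comul_tgt_mul; last by mlin.
rewrite -[t b]conv_id_antipode -(sw_appl _ _ (g := fun u : B => t a * u)); last by mlin.
by apply: eq_sw => x y; rewrite mulrA.
Qed.

Lemma src_mul_src a b : s (a * s b) = s a * s b.
Proof.
rewrite -conv_antipode_id comul_mul_src; last by mlin.
rewrite -[s a]conv_antipode_id -(sw_appl _ _ (g := fun u : B => u * s b)); last by mlin.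
by apply: eq_sw => x y; rewrite mulrA.
Qed.

Lemma tgt1 : t 1 = 1.
Proof.
rewrite /tgt -[RHS](sw_counitl coalgB 1 (g := fun u : B => u)) //.
by apply: eq_sw => x y; rewrite mulr1.
Qed.

Lemma src1 : s 1 = 1.
Proof.
rewrite /src -[RHS](sw_counitr coalgB 1 (g := fun u : B => u)) //.
by apply: eq_sw => x y; rewrite mul1r.
Qed.

Lemma conv_src_antipode a : \sw_(x, y <- Delta a) (s x * S y) = S a.
Proof.
rewrite -[RHS](whopf_antipode hB); apply: eq_sw => x y.
by rewrite -conv_antipode_id -(sw_appl _ _ (g := fun u : B => u * S y)); last by mlin.
Qed.

Lemma conv_antipode_tgt a : \sw_(x, y <- Delta a) (S x * t y) = S a.
Proof.
rewrite -[RHS](whopf_antipode hB).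
rewrite (sw_coassoc coalgB _ (f := fun x y z => S x * y * S z)); last by mlin.
apply: eq_sw => x y.
rewrite -conv_id_antipode -(sw_appl _ _ (g := fun u : B => S x * u)); last by mlin.
by apply: eq_sw => u v; rewrite mulrA.
Qed.

Lemma src_mul_sw a b : s (a * b) = \sw_(x, y <- Delta b) (S x * (s a * y)).
Proof. by rewrite -src_src_mul -conv_antipode_id comul_src_mul; last by mlin. Qed.

Lemma tgt_mul_sw a b : t (a * b) = \sw_(x, y <- Delta a) (x * t b * S y).
Proof. by rewrite -tgt_mul_tgt -conv_id_antipode comul_mul_tgt; last by mlin. Qed.

(** In the convolution algebra of bilinear maps, both [S(ab)] and [S(b)S(a)] are
    generalized inverses of the product [ab], with the same left unit [s(ab)] and
    the same right unit [t(ab)] ([src_mul_sw], [tgt_mul_sw]); such an inverse is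
    unique.  Unfolded:
    [S(ab) = s(a1 b1) S(a2 b2) = S(b1) S(a1) t(a2 b2)
           = S(b1) s(a1) t(b2) S(a2) = S(b) S(a)]. *)
Lemma antipodeM a b : S (a * b) = S b * S a.
Proof.
(* S(ab) = s(a1 b1) S(a2 b2) = S(b1) S(a1) a2 b2 S(a3 b3) *)
transitivity (\sw_(x, y <- Delta b) \sw_(u, v <- Delta a)
                (S x * (S u * t (v * y)))).
  rewrite -conv_src_antipode sw_comulM; last by mlin.
  transitivity (\sw_(u, v <- Delta a) \sw_(z, y' <- Delta b) \sw_(x, y <- Delta z)
                  (S x * (s u * y) * S (v * y'))).
    apply: eq_sw => u v; apply: eq_sw => z y'.
    rewrite src_mul_sw.
    by rewrite -(sw_appl _ _ (g := fun w : B => w * _)); last by mlin.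
  transitivity (\sw_(x, w <- Delta b) \sw_(y, y' <- Delta w) \sw_(u, v <- Delta a)
                  (S x * (s u * y) * S (v * y'))).
    rewrite exchange_sw.
    rewrite -(sw_coassoc coalgB _ (f := fun x y y' =>
      \sw_(u, v <- Delta a) (S x * (s u * y) * S (v * y')))); last by mlin.
    apply: eq_sw => z y'; rewrite exchange_sw; apply: eq_sw => x y; by [].
  apply: eq_sw => x w.
  transitivity (\sw_(y, y' <- Delta w) \sw_(u, c <- Delta a) \sw_(v, v' <- Delta c)
                  (S x * (S u * (v * y * S (v' * y'))))).
    apply: eq_sw => y y'.
    rewrite -(sw_coassoc coalgB _ (f := fun u v v' =>
      S x * (S u * (v * y * S (v' * y'))))); last by mlin.
    apply: eq_sw => c v'; rewrite -conv_antipode_id.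
    rewrite -(sw_appl _ _ (g := fun w : B => S x * (w * y) * _)); last by mlin.
    by apply: eq_sw => u v; rewrite !mulrA.
  rewrite exchange_sw; apply: eq_sw => u c.
  rewrite -conv_id_antipode sw_comulM; last by mlin.
  rewrite exchange_sw -(sw_appl _ _ (g := fun w : B => S x * (S u * w)));
    last by mlin.
  apply: eq_sw => v v'.
  by rewrite -(sw_appl _ _ (g := fun w : B => S x * (S u * w))); last by mlin.
(* t(ab) = a1 t(b) S(a2) turns S(a1) t(a2 b) into s(a1) t(b) S(a2) *)
transitivity (\sw_(x, y <- Delta b) \sw_(u, v <- Delta a)
                (S x * (s u * (t y * S v)))).
  apply: eq_sw => x y.
  transitivity (\sw_(u, c <- Delta a) \sw_(v, w <- Delta c)
                  (S x * (S u * (v * t y * S w)))).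
    apply: eq_sw => u v; rewrite tgt_mul_sw.
    by rewrite -(sw_appl _ _ (g := fun w : B => S x * (S u * w))); last by mlin.
  rewrite -(sw_coassoc coalgB _ (f := fun u v w => S x * (S u * (v * t y * S w))));
    last by mlin.
  apply: eq_sw => c w; rewrite -conv_antipode_id.
  rewrite -(sw_appl _ _ (g := fun z : B => S x * (z * (t y * S w)))); last by mlin.
  by apply: eq_sw => u v; rewrite !mulrA.
rewrite -[S b in RHS]conv_antipode_tgt.
rewrite -(sw_appl _ _ (g := fun w : B => w * S a)); last by mlin.
apply: eq_sw => x y; rewrite -[S a in RHS]conv_src_antipode.
rewrite -(sw_appl _ _ (g := fun w : B => _ * w)); last by mlin.
by apply: eq_sw => u v; rewrite !mulrA -[S x * s u * t y]mulrA -tgt_srcC mulrA.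
Qed.

Lemma antipode1 : S 1 = 1.
Proof.
rewrite -conv_src_antipode (comul1_src (f := fun x y => x * S y)); last by mlin.
by rewrite conv_id_antipode tgt1.
Qed.

(** Compute [t (s a)] as [x1 S(x2)] with [Delta(s a) = 1_1 (x) s a 1_2] and pull
    [S (s a)] out by antimultiplicativity. *)
Lemma antipode_of_src a : S (s a) = t (s a).
Proof.
rewrite -conv_id_antipode comul_src_left; last by mlin.
transitivity (\sw_(x, y <- Delta 1) (x * S y * S (s a))).
  by rewrite (sw_appl _ _ (g := fun w : B => w * _)) ?conv_id_antipode ?tgt1 ?mul1r //;
    mlin.
by apply: eq_sw => x y; rewrite antipodeM mulrA.
Qed.

Lemma antipode_of_tgt a : S (t a) = s (t a).
Proof.
rewrite -conv_antipode_id comul_tgt_right; last by mlin.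
transitivity (\sw_(x, y <- Delta 1) (S (t a) * (S x * y))).
  by rewrite (sw_appl _ _ (g := fun w : B => _ * w)) ?conv_antipode_id ?src1 ?mulr1 //;
    mlin.
by apply: eq_sw => x y; rewrite antipodeM mulrA.
Qed.

(** Write [Delta(a) = Delta(1) Delta(a)] and expand [t]: the second leg of the
    copy of [Delta(1)] meets the first leg of another one, so both merge into the
    threefold coproduct of [1], and what results is the counit applied to the
    second leg of [Delta(1_1 a)]. *)
Lemma sw_tgt_snd V a (f : B -> B -> V) : bilinear_map f ->
  \sw_(x, y <- Delta a) f x (t y) = \sw_(x, y <- Delta 1) f (x * a) y.
Proof.
move=> hf.
rewrite -(sw_comulMl1 a (f := fun x y => f x (t y))); last by mlin.
transitivity (\sw_(x, w <- Delta 1) \sw_(y, z <- Delta w) \sw_(u, v <- Delta a)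
  (eps (y * v) *: f (x * u) z)).
  rewrite (comul1r (f := fun x y z => \sw_(u, v <- Delta a)
    (eps (y * v) *: f (x * u) z))); last by mlin.
  apply: eq_sw => x y; rewrite exchange_sw; apply: eq_sw => u v.
  rewrite (tgt_appl (g := fun z => f (x * u) z)); last by mlin.
  by apply: eq_sw => y' z; rewrite mulrA.
rewrite -(sw_coassoc coalgB _ (f := fun x y z => \sw_(u, v <- Delta a)
    (eps (y * v) *: f (x * u) z))); last by mlin.
apply: eq_sw => w z.
rewrite -(sw_comulM w a (f := fun x y => eps y *: f x z)); last by mlin.
by rewrite (sw_counitr coalgB _ (g := fun x => f x z)); last by mlin.
Qed.

Lemma sw_src_fst V a (f : B -> B -> V) : bilinear_map f ->
  \sw_(x, y <- Delta a) f (s x) y = \sw_(x, y <- Delta 1) f x (a * y).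
Proof.
move=> hf.
rewrite -(sw_comulMr1 a (f := fun x y => f (s x) y)); last by mlin.
transitivity (\sw_(x, w <- Delta 1) \sw_(y, z <- Delta w) \sw_(u, v <- Delta a)
  (eps (u * y) *: f x (v * z))).
  rewrite (comul1r (f := fun x y z => \sw_(u, v <- Delta a)
    (eps (u * y) *: f x (v * z)))); last by mlin.
  rewrite exchange_sw [RHS]exchange_sw; apply: eq_sw => y' z.
  rewrite exchange_sw; apply: eq_sw => u v.
  rewrite (src_appl (g := fun x => f x (v * z))); last by mlin.
  by apply: eq_sw => x y; rewrite mulrA.
apply: eq_sw => x w.
rewrite exchange_sw -(sw_comulM a w (f := fun y z => eps y *: f x z)); last by mlin.
by rewrite (sw_counitl coalgB _ (g := fun z => f x z)); last by mlin.
Qed.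

(** For [y = s a] one has [1_1 y (x) 1_2 = y1 (x) t(y2) = 1_1 (x) t(1_2 y)
    = 1_1 (x) 1_2 t(y)] and [t(y) = S(y)]; the case of general [b] follows by
    writing [Delta(b) = Delta(b) Delta(1)]. *)
Lemma move_src_right V b a (f : B -> B -> V) : bilinear_map f ->
  \sw_(x, y <- Delta b) f (x * s a) y = \sw_(x, y <- Delta b) f x (y * S (s a)).
Proof.
move=> hf.
have comul1_src_tgt (g : B -> B -> V) : bilinear_map g ->
    \sw_(x, y <- Delta 1) g (x * s a) y
    = \sw_(x, y <- Delta 1) g x (y * S (s a)).
  move=> hg; rewrite antipode_of_src -sw_tgt_snd // comul_src_right; last by mlin.
  rewrite -(comul1_tgt (f := fun x y => g x (y * t (s a)))); last by mlin.
  rewrite -(comul1_tgt (f := fun x y => g x (t (y * s a)))); last by mlin.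
  by apply: eq_sw => x y; rewrite -tgt_tgt_mul.
rewrite -(sw_comulMr1 b (f := fun x y => f (x * s a) y)); last by mlin.
rewrite -(sw_comulMr1 b (f := fun x y => f x (y * S (s a)))); last by mlin.
apply: eq_sw => x y.
transitivity (\sw_(u, v <- Delta 1) f (x * (u * s a)) (y * v)).
  by apply: eq_sw => u v; rewrite mulrA.
rewrite (comul1_src_tgt (fun u v => f (x * u) (y * v))); last by mlin.
by apply: eq_sw => u v; rewrite mulrA.
Qed.

Lemma move_tgt_left V b a (f : B -> B -> V) : bilinear_map f ->
  \sw_(x, y <- Delta b) f x (t a * y) = \sw_(x, y <- Delta b) f (S (t a) * x) y.
Proof.
move=> hf.
have comul1_tgt_src (g : B -> B -> V) : bilinear_map g ->
    \sw_(x, y <- Delta 1) g x (t a * y)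
    = \sw_(x, y <- Delta 1) g (S (t a) * x) y.
  move=> hg; rewrite antipode_of_tgt -sw_src_fst // comul_tgt_left; last by mlin.
  rewrite -(comul1_src (f := fun x y => g (s (t a) * x) y)); last by mlin.
  rewrite -(comul1_src (f := fun x y => g (s (t a * x)) y)); last by mlin.
  by apply: eq_sw => x y; rewrite -src_mul_src.
rewrite -(sw_comulMl1 b (f := fun x y => f x (t a * y))); last by mlin.
rewrite -(sw_comulMl1 b (f := fun x y => f (S (t a) * x) y)); last by mlin.
rewrite exchange_sw [RHS]exchange_sw; apply: eq_sw => x y.
transitivity (\sw_(u, v <- Delta 1) f (u * x) (t a * v * y)).
  by apply: eq_sw => u v; rewrite mulrA.
rewrite (comul1_tgt_src (fun u v => f (u * x) (v * y))); last by mlin.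
by apply: eq_sw => u v; rewrite mulrA.
Qed.

(** The legs of [Delta(1)] being in [im s] and [im t], the left side is
    [s(1_2) (x) t(1_1)].  Expanding both counital maps leaves the scalar
    [eps(1''_1 1_1) eps(1_2 1'_2)], which the axiom on the counit of a triple
    product contracts to [eps(1''_1 1'_2)]; the result is the threefold coproduct
    of [1] with the counit applied in the middle. *)
Lemma comul1_antipode V (f : B -> B -> V) : bilinear_map f ->
  \sw_(x, y <- Delta 1) f (S y) (S x) = \sw_(x, y <- Delta 1) f x y.
Proof.
move=> hf.
rewrite -(comul1_tgt (f := fun x y => f (S y) (S x))); last by mlin.
rewrite -(comul1_src (f := fun x y => f (S (t y)) (S x))); last by mlin.
transitivity (\sw_(u, v <- Delta 1) \sw_(u', v' <- Delta 1) (eps (u' * v) *: f u v')).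
  transitivity (\sw_(x, y <- Delta 1) f (s y) (t x)).
    rewrite -(comul1_tgt (f := fun x y => f (s y) (t x))); last by mlin.
    rewrite -(comul1_src (f := fun x y => f (s (t y)) (t x))); last by mlin.
    by apply: eq_sw => x y; rewrite antipode_of_src antipode_of_tgt.
  transitivity (\sw_(x, y <- Delta 1) \sw_(u, v <- Delta 1) \sw_(u', v' <- Delta 1)
     ((eps (u' * x) * eps (y * v)) *: f u v')).
    apply: eq_sw => x y.
    rewrite (src_appl (g := fun u => f u (t x))); last by mlin.
    apply: eq_sw => u v.
    rewrite (tgt_appl (g := fun w => _ *: f u w)); last by mlin.
    by apply: eq_sw => u' v'; rewrite scalerA.
  rewrite exchange_sw; apply: eq_sw => u v.
  rewrite exchange_sw; apply: eq_sw => u' v'.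
  rewrite -[u' in RHS]mulr1 (whopf_counitMl hB).
  by rewrite /sweedler scaler_suml.
rewrite -(comul1r (f := fun x y z => eps y *: f x z)); last by mlin.
by apply: eq_sw => x w; rewrite (sw_counitl coalgB); last by mlin.
Qed.

(** As [eps] absorbs [s] on the left, [eps(S a) = eps(s(a1) S(a2))] equals
    [eps(a1 S(a2)) = eps(t a) = eps a]. *)
Lemma counit_antipode a : eps (S a) = eps a.
Proof.
rewrite -conv_src_antipode.
rewrite -(sw_appl _ _ (g := fun u => eps u : F^o)); last by mlin.
transitivity (eps (t a)).
  rewrite -conv_id_antipode -(sw_appl _ _ (g := fun u => eps u : F^o)); last by mlin.
  by apply: eq_sw => x y; rewrite counit_src_mul.
by rewrite -[t a]mul1r counit_mul_tgt mul1r.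
Qed.
End WeakHopf.

(** * Hopf algebras are weak Hopf algebras *)

Section HopfIsWeakHopf.
Variables (F : fieldType) (H : ualgType F) (D : hopfData H).
Hypothesis hH : is_hopf D.

Lemma hopf_is_weak_hopf : is_weak_hopf D.
Proof.
have coalgH := hopf_coalgebra hH.
have [D1 DM] := hopf_comulM hH; have [e1 eM] := hopf_counitM hH.
have comul1E : comul D 1 = (1 : H) \ot (1 : H) by rewrite D1.
have counitM2 a b c :
    \sw_(x, y <- comul D b) (counit D (a * x) * counit D (y * c))
    = counit D (a * b * c).
  have epsb : \sw_(x, y <- comul D b) (counit D x * counit D y) = counit D b.
    by apply: (sw_counitl coalgH b (g := fun y => counit D y : F^o)); mlin.
  rewrite !eM -epsb /sweedler mulr_sumr mulr_suml.
  by apply: eq_bigr => q _; rewrite !eM !mulrA.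
split=> //.
- rewrite comul1E {1}/tmap sw_pure; last by mlin.
  rewrite comul1E /tassoc !sw_pure; [|by mlin..].
  by rewrite !mul_tpure !mulr1.
- rewrite comul1E {1}/tmap sw_pure; last by mlin.
  rewrite comul1E /tassoc !sw_pure; [|by mlin..].
  by rewrite !mul_tpure !mulr1.
- move=> a b c; rewrite -counitM2; apply: eq_bigr => q _.
  by rewrite !eM mulrACA.
- move=> a; rewrite (hopf_antipode_r hH) comul1E sw_pure ?mul1r //; mlin.
- move=> a; rewrite (hopf_antipode_l hH) comul1E sw_pure ?mulr1 //; mlin.
- move=> a.
  rewrite -[RHS](sw_counitl coalgH a (g := antipode D)); last by mlin.
  apply: eq_sw => u z; rewrite (sw_appl _ _ (g := fun w : H => w * _)); last by mlin.
  by rewrite (hopf_antipode_l hH) -uscalerAl mul1r.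
Qed.
End HopfIsWeakHopf.

(** * The universal algebra under a class of linear maps *)

Section Terms.
Variables (F : fieldType) (B : lmodType F).

(** Formal expressions in the generators.  There is no constructor for zero or
    for opposites: these are scalar multiples. *)
Inductive aterm : Type :=
  | AGen of B
  | AOne
  | AAdd of aterm & aterm
  | AMul of aterm & aterm
  | AScale of F & aterm.

HB.instance Definition _ := gen_eqMixin aterm.
HB.instance Definition _ := gen_choiceMixin aterm.

Fixpoint aeval (C : ualgType F) (p : B -> C) (u : aterm) : C :=
  match u with
  | AGen b => p b
  | AOne => 1
  | AAdd u v => aeval p u + aeval p v
  | AMul u v => aeval p u * aeval p v
  | AScale c u => c *: aeval p u
  end.

End Terms.

Section UniversalAlgebra.
Local Open Scope quotient_scope.
Variables (F : fieldType) (B : lmodType F).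
Variable adm : forall C : ualgType F, {linear B -> C} -> Prop.
Local Notation aterm := (aterm B).
Implicit Types u v w : aterm.

(** The congruence is the intersection of the kernels of all admissible
    evaluations.  It is impredicative, and this makes every algebra law of the
    quotient a consequence of the same law in each target. *)
Definition aequiv u v : bool :=
  `[< forall (C : ualgType F) (p : {linear B -> C}), adm p ->
        aeval p u = aeval p v >].

Lemma aequiv_refl : reflexive aequiv.
Proof. by move=> u; apply/asboolP. Qed.

Lemma aequiv_sym : symmetric aequiv.
Proof. by move=> u v; apply/asboolP/asboolP => h C p hp; rewrite (h C p). Qed.

Lemma aequiv_trans : transitive aequiv.
Proof.
move=> v u w /asboolP uv /asboolP vw; apply/asboolP => C p hp.
by rewrite (uv C p) // (vw C p).
Qed.

Canonical aequiv_equiv := EquivRel aequiv aequiv_refl aequiv_sym aequiv_trans.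

Definition univ_alg := {eq_quot aequiv_equiv}.

HB.instance Definition _ := Choice.on univ_alg.
HB.instance Definition _ := EqQuotient.on univ_alg.

Implicit Types x y z : univ_alg.

Definition aclass u : univ_alg := \pi_univ_alg u.

Section Lift.
Variables (C : ualgType F) (p : {linear B -> C}).

Definition ulift (hp : adm p) x : C := aeval p (repr x).

Lemma ulift_class (hp : adm p) u : ulift hp (aclass u) = aeval p u.
Proof.
suff /asboolP/(_ C p hp) : aequiv (repr (aclass u)) u by [].
rewrite -[aequiv]/(aequiv_equiv : rel _).
by apply/eqmodP; rewrite reprK.
Qed.

End Lift.

(** Immediate from the choice of the congruence; every law and every relation of
    the universal algebra is obtained through this lemma. *)
Lemma univ_eq x y :
  (forall (C : ualgType F) (p : {linear B -> C}) (hp : adm p),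
    ulift hp x = ulift hp y) -> x = y.
Proof.
move=> h; rewrite -[x]reprK -[y]reprK; apply/eqmodP/asboolP => C p hp.
exact: (h C p hp).
Qed.

Definition uadd x y := aclass (AAdd (repr x) (repr y)).
Definition umul x y := aclass (AMul (repr x) (repr y)).
Definition uscale c x := aclass (AScale c (repr x)).
Definition uone := aclass (AOne B).
Definition uzero := uscale 0 uone.
Definition uopp x := uscale (-1) x.

Let uliftE (C : ualgType F) (p : {linear B -> C}) (hp : adm p) :
  (forall x y, ulift hp (uadd x y) = ulift hp x + ulift hp y) *
  (forall x y, ulift hp (umul x y) = ulift hp x * ulift hp y) *
  (forall c x, ulift hp (uscale c x) = c *: ulift hp x) *
  (forall x, ulift hp (uopp x) = - ulift hp x) *
  (ulift hp uone = 1) * (ulift hp uzero = 0).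
Proof.
split; first split; first split; first split; first split.
- by move=> x y; rewrite ulift_class.
- by move=> x y; rewrite ulift_class.
- by move=> c x; rewrite ulift_class.
- by move=> x; rewrite ulift_class //= scaleN1r.
- by rewrite ulift_class.
- by rewrite ulift_class //= scale0r.
Qed.

Lemma uaddA : associative uadd.
Proof. by move=> x y z; apply: univ_eq => C p hp; rewrite !(uliftE hp) addrA. Qed.

Lemma uaddC : commutative uadd.
Proof. by move=> x y; apply: univ_eq => C p hp; rewrite !(uliftE hp) addrC. Qed.

Lemma uadd0 : left_id uzero uadd.
Proof. by move=> x; apply: univ_eq => C p hp; rewrite !(uliftE hp) add0r. Qed.

Lemma uaddN : left_inverse uzero uopp uadd.
Proof. by move=> x; apply: univ_eq => C p hp; rewrite !(uliftE hp) addNr. Qed.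

HB.instance Definition _ := GRing.isZmodule.Build univ_alg uaddA uaddC uadd0 uaddN.

Lemma uscaleA a b x : uscale a (uscale b x) = uscale (a * b) x.
Proof. by apply: univ_eq => C p hp; rewrite !(uliftE hp) scalerA. Qed.

Lemma uscale1 : left_id 1 uscale.
Proof. by move=> x; apply: univ_eq => C p hp; rewrite !(uliftE hp) scale1r. Qed.

Lemma uscaleDr : right_distributive uscale +%R.
Proof. by move=> a x y; apply: univ_eq => C p hp; rewrite !(uliftE hp) scalerDr. Qed.

Lemma uscaleDl x : {morph uscale^~ x : a b / a + b}.
Proof. by move=> a b; apply: univ_eq => C p hp; rewrite !(uliftE hp) scalerDl. Qed.

HB.instance Definition _ := GRing.Zmodule_isLmodule.Build F univ_alg
  uscaleA uscale1 uscaleDr uscaleDl.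

Lemma umulA : associative umul.
Proof. by move=> x y z; apply: univ_eq => C p hp; rewrite !(uliftE hp) mulrA. Qed.

Lemma umul1l : left_id uone umul.
Proof. by move=> x; apply: univ_eq => C p hp; rewrite !(uliftE hp) mul1r. Qed.

Lemma umul1r : right_id uone umul.
Proof. by move=> x; apply: univ_eq => C p hp; rewrite !(uliftE hp) mulr1. Qed.

Lemma umulDl : left_distributive umul +%R.
Proof. by move=> x y z; apply: univ_eq => C p hp; rewrite !(uliftE hp) mulrDl. Qed.

Lemma umulDr : right_distributive umul +%R.
Proof. by move=> x y z; apply: univ_eq => C p hp; rewrite !(uliftE hp) mulrDr. Qed.

Lemma uscaleAl c x y : c *: umul x y = umul (c *: x) y.
Proof. by apply: univ_eq => C p hp; rewrite !(uliftE hp) uscalerAl. Qed.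

Lemma uscaleAr c x y : c *: umul x y = umul x (c *: y).
Proof. by apply: univ_eq => C p hp; rewrite !(uliftE hp) uscalerAr. Qed.

HB.instance Definition _ := Lmodule_isUAlgebra.Build F univ_alg
  umulA umul1l umul1r umulDl umulDr uscaleAl uscaleAr.

HB.instance Definition _ := GRing.Zmodule_isPzRing.Build univ_alg
  umulA umul1l umul1r umulDl umulDr.

Definition ugen (b : B) : univ_alg := aclass (AGen b).

Lemma ugen_linear : linear ugen.
Proof.
by move=> c a b; apply: univ_eq => C p hp; rewrite !(uliftE hp) !ulift_class //= linearP.
Qed.

HB.instance Definition _ := GRing.isLinear.Build F B univ_alg *:%R ugen ugen_linear.

(** The universal algebra is generated by the image of [ugen], whence the
    uniqueness of morphisms out of it. *)
Lemma univ_ind (P : univ_alg -> Prop) :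
  (forall b, P (ugen b)) -> P 1 ->
  (forall x y, P x -> P y -> P (x + y)) ->
  (forall x y, P x -> P y -> P (x * y)) ->
  (forall c x, P x -> P (c *: x)) -> forall x, P x.
Proof.
move=> Pg P1 PD PM PZ x.
have classD u v : aclass (AAdd u v) = aclass u + aclass v.
  by apply: univ_eq => C p hp; rewrite !(uliftE hp) !ulift_class.
have classM u v : aclass (AMul u v) = aclass u * aclass v.
  by apply: univ_eq => C p hp; rewrite !(uliftE hp) !ulift_class.
have classZ c u : aclass (AScale c u) = c *: aclass u.
  by apply: univ_eq => C p hp; rewrite !(uliftE hp) !ulift_class.
rewrite -[x]reprK -/(aclass _).
elim: (repr x) => [b||u Pu v Pv|u Pu v Pv|c u Pu]; first exact: Pg.
- exact: P1.
- by rewrite classD; apply: PD.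
- by rewrite classM; apply: PM.
- by rewrite classZ; apply: PZ.
Qed.

Section LiftMorphism.
Variables (C : ualgType F) (p : {linear B -> C}) (hp : adm p).

Lemma ulift_linear : linear (ulift hp).
Proof. by move=> c x y; rewrite !(uliftE hp). Qed.

HB.instance Definition _ :=
  GRing.isLinear.Build F univ_alg C *:%R (ulift hp) ulift_linear.

Lemma ulift_monoid_morphism : monoid_morphism (ulift hp).
Proof. by split=> [|x y]; rewrite !(uliftE hp). Qed.

Lemma ulift_gen b : ulift hp (ugen b) = p b.
Proof. exact: ulift_class. Qed.

End LiftMorphism.

Lemma univ_morphism_unique (C : ualgType F) (g g' : univ_alg -> C) :
  linear g -> linear g' -> monoid_morphism g -> monoid_morphism g' ->
  (forall b, g (ugen b) = g' (ugen b)) -> g =1 g'.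
Proof.
move=> gL g'L [g1 gM] [g'1 g'M] gg' x.
elim/univ_ind: x => [b||x y hx hy|x y hx hy|c x hx].
- exact: gg'.
- by rewrite g1 g'1.
- by rewrite !linear_mapD // hx hy.
- by rewrite gM g'M hx hy.
- by rewrite !linear_mapZ // hx.
Qed.

End UniversalAlgebra.

(** * Birelatively multiplicative maps derived from a given one *)

Section ScalarAlgebra.
Variable F : fieldType.

(** The ground field as an algebra over itself, so that the counit can be lifted
    like the other structure maps. *)
Definition scalar_alg : Type := F^o.

HB.instance Definition _ := GRing.Lmodule.on scalar_alg.

Let smul : scalar_alg -> scalar_alg -> scalar_alg := fun x y : F => x * y.
Let sone : scalar_alg := (1 : F).

Let smulA : associative smul. Proof. exact: mulrA. Qed.
Let smul1l : left_id sone smul. Proof. exact: mul1r. Qed.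
Let smul1r : right_id sone smul. Proof. exact: mulr1. Qed.
Let smulDl : left_distributive smul +%R. Proof. exact: mulrDl. Qed.
Let smulDr : right_distributive smul +%R. Proof. exact: mulrDr. Qed.
Let sscaleAl (c : F) (x y : scalar_alg) : c *: smul x y = smul (c *: x) y.
Proof. exact: mulrA. Qed.
Let sscaleAr (c : F) (x y : scalar_alg) : c *: smul x y = smul x (c *: y).
Proof. exact: mulrCA. Qed.

HB.instance Definition _ := Lmodule_isUAlgebra.Build F scalar_alg
  smulA smul1l smul1r smulDl smulDr sscaleAl sscaleAr.

End ScalarAlgebra.

Section OppositeAlgebra.
Variables (F : fieldType) (A : ualgType F).

Definition opp_alg : Type := A.

HB.instance Definition _ := GRing.Lmodule.on opp_alg.

Let omul : opp_alg -> opp_alg -> opp_alg := fun x y : A => y * x.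
Let oone : opp_alg := (1 : A).

Let omulA : associative omul.
Proof. by move=> x y z; rewrite /omul mulrA. Qed.
Let omul1l : left_id oone omul. Proof. exact: mulr1. Qed.
Let omul1r : right_id oone omul. Proof. exact: mul1r. Qed.
Let omulDl : left_distributive omul +%R.
Proof. by move=> x y z; exact: mulrDr. Qed.
Let omulDr : right_distributive omul +%R.
Proof. by move=> x y z; exact: mulrDl. Qed.
Let oscaleAl (c : F) (x y : opp_alg) : c *: omul x y = omul (c *: x) y.
Proof. exact: uscalerAr. Qed.
Let oscaleAr (c : F) (x y : opp_alg) : c *: omul x y = omul x (c *: y).
Proof. exact: uscalerAl. Qed.

HB.instance Definition _ := Lmodule_isUAlgebra.Build F opp_alg
  omulA omul1l omul1r omulDl omulDr oscaleAl oscaleAr.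

End OppositeAlgebra.

Section DerivedMaps.
Variables (F : fieldType) (B C : ualgType F) (D : hopfData B) (p : {linear B -> C}).

Definition counit_alg (b : B) : scalar_alg F := counit D b.
Definition comul_map (b : B) : tensor C C := tmap p p (comul D b).
Definition antipode_map (b : B) : opp_alg C := p (antipode D b).

Lemma counit_alg_linear : linear counit_alg.
Proof. by move=> c x y; rewrite /counit_alg linearP. Qed.

Lemma comul_map_linear : linear comul_map.
Proof. by rewrite /comul_map /tmap; mlin. Qed.

Lemma antipode_map_linear : linear antipode_map.
Proof. by move=> c x y; rewrite /antipode_map !linearP. Qed.

HB.instance Definition _ :=
  GRing.isLinear.Build F B (scalar_alg F) *:%R counit_alg counit_alg_linear.
HB.instance Definition _ :=
  GRing.isLinear.Build F B (tensor C C) *:%R comul_map comul_map_linear.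
HB.instance Definition _ :=
  GRing.isLinear.Build F B (opp_alg C) *:%R antipode_map antipode_map_linear.

Hypothesis hB : is_weak_hopf D.

(** Since [S(s a) = t(s a)] and [eps] absorbs [t] on the right, the antipode
    disappears and the claim is [eps(ab) = eps(a 1_1) eps(1_2 b)]; likewise
    on the other side. *)
Lemma counit_birel : birel_multiplicative D counit_alg.
Proof.
split=> a b.
- transitivity (\sw_(x, y <- comul D 1) (counit D (a * x) * counit D (y * b))).
    rewrite -(comul1_src hB
      (f := fun x y => counit D (a * antipode D x) *: (counit D (y * b) : F^o)));
      last by mlin.
    rewrite -[RHS](comul1_src hB
      (f := fun x y => counit D (a * x) *: (counit D (y * b) : F^o)));
      last by mlin.
    apply: eq_sw => x y.
    by rewrite antipode_of_src // counit_mul_tgt.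
  by rewrite -(whopf_counitMl hB) mulr1.
- transitivity (\sw_(x, y <- comul D 1) (counit D (a * x) * counit D (y * b))).
    rewrite -(comul1_tgt hB
      (f := fun x y => counit D (a * x) *: (counit D (antipode D y * b) : F^o)));
      last by mlin.
    rewrite -[RHS](comul1_tgt hB
      (f := fun x y => counit D (a * x) *: (counit D (y * b) : F^o)));
      last by mlin.
    apply: eq_sw => x y.
    by rewrite antipode_of_tgt // counit_src_mul.
  by rewrite -(whopf_counitMl hB) mulr1.
Qed.

Hypothesis hp : birel_multiplicative D p.

(** Antimultiplicativity and [S(1_2) (x) S(1_1) = 1_1 (x) 1_2] exchange the two
    defining identities of a birelatively multiplicative map. *)
Lemma antipode_birel : birel_multiplicative D antipode_map.
Proof.
split=> a b.
- transitivity (\sw_(x, y <- comul D 1)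
    (p (antipode D b * antipode D y) * p (antipode D (antipode D x) * antipode D a))).
    by apply: eq_sw => x y; rewrite -!antipodeM.
  rewrite (comul1_antipode hB (f := fun u v => p (antipode D b * u) *
    p (antipode D v * antipode D a))); last by mlin.
  by rewrite (birel_mul_r hp) -antipodeM.
- transitivity (\sw_(x, y <- comul D 1)
    (p (antipode D b * antipode D (antipode D y)) * p (antipode D x * antipode D a))).
    by apply: eq_sw => x y; rewrite -!antipodeM.
  rewrite (comul1_antipode hB (f := fun u v => p (antipode D b * antipode D u) *
    p (v * antipode D a))); last by mlin.
  by rewrite (birel_mul_l hp) -antipodeM.
Qed.

(** With [S(1_1)] in [im t], the factor [S(1_1)] acts on the first leg of
    [Delta(a)] only, and [1_2] on the first leg of [Delta(b)] only; so birelative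
    multiplicativity joins the first legs into [p(a1 b1)] but leaves
    [p(a2) p(b2)] in the second.  Taking another copy of [Delta(1)] out of
    [Delta(b)] gives [p(a1 1_1 b1)] and [p(a2) p(1_2 b2)], and [move_src_right]
    carries [1_1] to the second leg: [p(a2 S(1_1)) p(1_2 b2)] is [p(a2 b2)].  The other identity is the
    mirror image. *)
Lemma comul_birel : birel_multiplicative D comul_map.
Proof.
split=> a b.
(* S(1_1) is S(s(1_1)) = t(s(1_1)), so it stays in the first leg. *)
- transitivity (\sw_(u, v <- comul D a) \sw_(u', v' <- comul D b)
                  (p (u * u') \ot (p v * p v'))).
    rewrite -(comul1_src hB
      (f := fun x y => comul_map (a * antipode D x) * comul_map (y * b)));
      last by mlin.
    rewrite -(comul1_tgt hB
      (f := fun x y => comul_map (a * antipode D (src D x)) * comul_map (y * b)));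
      last by mlin.
    transitivity (\sw_(x, y <- comul D 1)
      \sw_(u, v <- comul D a) \sw_(u', v' <- comul D b)
      ((p (u * antipode D (src D x)) * p (tgt D y * u')) \ot (p v * p v'))).
      apply: eq_sw => x y.
      rewrite antipode_of_src // /comul_map /tmap comul_mul_tgt //; last by mlin.
      rewrite comul_tgt_mul //; last by mlin.
      rewrite mul_sw; apply: eq_sw => u v; apply: eq_sw => u' v'.
      by rewrite mul_tpure.
    rewrite exchange_sw; apply: eq_sw => u v.
    rewrite exchange_sw; apply: eq_sw => u' v'.
    rewrite (comul1_tgt hB (f := fun x y =>
      (p (u * antipode D (src D x)) * p (y * u')) \ot (p v * p v'))); last by mlin.
    rewrite (comul1_src hB (f := fun x y =>
      (p (u * antipode D x) * p (y * u')) \ot (p v * p v'))); last by mlin.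
    rewrite (sw_appl _ _ (g := fun z => z \ot (p v * p v'))); last by mlin.
    by rewrite (birel_mul_l hp).
  rewrite -[RHS]/(\sw_(x, y <- comul D (a * b)) (p x \ot p y)).
  rewrite sw_comulM //; last by mlin.
  (* A copy of Delta(1), taken from Delta(b), feeds the transfer rule. *)
  transitivity (\sw_(x, y <- comul D 1) \sw_(u', v' <- comul D b)
    \sw_(u, v <- comul D a) (p (u * (x * u')) \ot (p v * p (y * v')))).
    rewrite exchange_sw.
    by rewrite -(sw_comulMl1 hB b (f := fun u' v' =>
      \sw_(u, v <- comul D a) (p (u * u') \ot (p v * p v')))); last by mlin.
  transitivity (\sw_(x, y <- comul D 1) \sw_(u', v' <- comul D b)
    \sw_(u, v <- comul D a)
    (p (u * u') \ot (p (v * antipode D x) * p (y * v')))).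
    rewrite -(comul1_src hB (f := fun x y => \sw_(u', v' <- comul D b)
      \sw_(u, v <- comul D a) (p (u * (x * u')) \ot (p v * p (y * v')))));
      last by mlin.
    rewrite -[RHS](comul1_src hB (f := fun x y => \sw_(u', v' <- comul D b)
      \sw_(u, v <- comul D a)
      (p (u * u') \ot (p (v * antipode D x) * p (y * v'))))); last by mlin.
    apply: eq_sw => x y; apply: eq_sw => u' v'.
    rewrite -(move_src_right hB a x (f := fun u v =>
      p (u * u') \ot (p v * p (y * v')))); last by mlin.
    by apply: eq_sw => u v; rewrite mulrA.
  rewrite exchange_sw [RHS]exchange_sw; apply: eq_sw => u' v'.
  rewrite exchange_sw; apply: eq_sw => u v.
  by rewrite (sw_appl _ _ (g := fun z => p (u * u') \ot z)) ?(birel_mul_l hp);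
    last by mlin.
- transitivity (\sw_(u, v <- comul D a) \sw_(u', v' <- comul D b)
                  ((p u * p u') \ot p (v * v'))).
    rewrite -(comul1_src hB
      (f := fun x y => comul_map (a * x) * comul_map (antipode D y * b)));
      last by mlin.
    rewrite -(comul1_tgt hB
      (f := fun x y => comul_map (a * src D x) * comul_map (antipode D y * b)));
      last by mlin.
    transitivity (\sw_(x, y <- comul D 1)
      \sw_(u, v <- comul D a) \sw_(u', v' <- comul D b)
      ((p u * p u') \ot (p (v * src D x) * p (antipode D (tgt D y) * v')))).
      apply: eq_sw => x y.
      rewrite antipode_of_tgt // /comul_map /tmap comul_mul_src //; last by mlin.
      rewrite comul_src_mul //; last by mlin.
      rewrite mul_sw; apply: eq_sw => u v; apply: eq_sw => u' v'.
      by rewrite mul_tpure.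
    rewrite exchange_sw; apply: eq_sw => u v.
    rewrite exchange_sw; apply: eq_sw => u' v'.
    rewrite (comul1_tgt hB (f := fun x y =>
      (p u * p u') \ot (p (v * src D x) * p (antipode D y * v')))); last by mlin.
    rewrite (comul1_src hB (f := fun x y =>
      (p u * p u') \ot (p (v * x) * p (antipode D y * v')))); last by mlin.
    rewrite (sw_appl _ _ (g := fun z => (p u * p u') \ot z)); last by mlin.
    by rewrite (birel_mul_r hp).
  rewrite -[RHS]/(\sw_(x, y <- comul D (a * b)) (p x \ot p y)).
  rewrite sw_comulM //; last by mlin.
  transitivity (\sw_(u, v <- comul D a) \sw_(x, y <- comul D 1)
    \sw_(u', v' <- comul D b) ((p (u * x) * p u') \ot p (v * y * v'))).
    by rewrite -(sw_comulMr1 hB a (f := fun u v =>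
      \sw_(u', v' <- comul D b) ((p u * p u') \ot p (v * v')))); last by mlin.
  apply: eq_sw => u v.
  transitivity (\sw_(x, y <- comul D 1) \sw_(u', v' <- comul D b)
    ((p (u * x) * p (antipode D y * u')) \ot p (v * v'))).
    rewrite -(comul1_tgt hB (f := fun x y => \sw_(u', v' <- comul D b)
      ((p (u * x) * p u') \ot p (v * y * v')))); last by mlin.
    rewrite -[RHS](comul1_tgt hB (f := fun x y => \sw_(u', v' <- comul D b)
      ((p (u * x) * p (antipode D y * u')) \ot p (v * v')))); last by mlin.
    apply: eq_sw => x y.
    rewrite -(move_tgt_left hB b y (f := fun u' v' =>
      (p (u * x) * p u') \ot p (v * v'))); last by mlin.
    by apply: eq_sw => u' v'; rewrite mulrA.
  rewrite exchange_sw; apply: eq_sw => u' v'.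
  by rewrite (sw_appl _ _ (g := fun z => z \ot p (v * v'))) ?(birel_mul_r hp);
    last by mlin.
Qed.

(** Write [Delta(b) = Delta(1) Delta(b)]: then [S(1_1 b1) (x) 1_2 b2 =
    S(b1) S(1_1) (x) 1_2 b2] is the pattern that [p] multiplies. *)
Lemma birel_antipode_l b :
  \sw_(x, y <- comul D b) (p (antipode D x) * p y) = p (src D b).
Proof.
rewrite -(sw_comulMl1 hB b (f := fun x y => p (antipode D x) * p y)); last by mlin.
rewrite -conv_antipode_id // -(sw_appl _ _ (g := fun u => p u)); last by mlin.
rewrite exchange_sw; apply: eq_sw => x y; rewrite -(birel_mul_l hp).
by apply: eq_sw => u v; rewrite antipodeM.
Qed.

Lemma birel_antipode_r b :
  \sw_(x, y <- comul D b) (p x * p (antipode D y)) = p (tgt D b).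
Proof.
rewrite -(sw_comulMr1 hB b (f := fun x y => p x * p (antipode D y))); last by mlin.
rewrite -conv_id_antipode // -(sw_appl _ _ (g := fun u => p u)); last by mlin.
apply: eq_sw => x y; rewrite -(birel_mul_r hp).
by apply: eq_sw => u v; rewrite antipodeM.
Qed.

End DerivedMaps.

(** * Tensor products of algebra morphisms *)

Section TensorMaps.
Variable F : fieldType.
Implicit Types A B C : ualgType F.

Lemma tmap_monoid_morphism A B A' B' (f : A -> A') (g : B -> B') :
  linear f -> linear g -> monoid_morphism f -> monoid_morphism g ->
  monoid_morphism (tmap f g).
Proof.
move=> fL gL [f1 fM] [g1 gM]; split=> [|t u].
  by rewrite /tmap [LHS]sw_pure ?f1 ?g1 //; mlin.
rewrite /tmap sw_mul ?mul_sw; last by mlin.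
by apply: eq_sw => x y; apply: eq_sw => x' y'; rewrite fM gM mul_tpure.
Qed.

Lemma tassoc_monoid_morphism A B C :
  monoid_morphism (@tassoc F A B C : tensor (tensor A B) C -> _).
Proof.
have tassocE (u : tensor A B) (z : C) :
    tassoc (u \ot z) = \sw_(x, y <- u) (x \ot (y \ot z)).
  by rewrite /tassoc sw_pure; last by mlin.
have tassocL : linear (@tassoc F A B C) by rewrite /tassoc; mlin.
split=> [|t u].
  rewrite -[LHS]/(tassoc (((1 : A) \ot (1 : B)) \ot (1 : C))) tassocE sw_pure; last by mlin.
  by [].
rewrite [t]tensor_decomp [u]tensor_decomp.
rewrite mul_sw -!(sw_appl _ _ tassocL).
rewrite mul_sw; apply: eq_sw => x z; rewrite -(sw_appl _ _ tassocL).
apply: eq_sw => x' z'; rewrite mul_tpure !tassocE sw_mul; last by mlin.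
rewrite mul_sw; apply: eq_sw => v w; apply: eq_sw => v' w'.
by rewrite !mul_tpure.
Qed.

End TensorMaps.

(** * The cokernel and its Hopf structure *)

Section Cokernel.
Variables (F : fieldType) (A B : ualgType F) (DA : hopfData A) (DB : hopfData B).
Variable k : {linear A -> B}.

(** Admissibility, the property to which the universal construction is applied. *)
Definition kills (C : ualgType F) (p : {linear B -> C}) : Prop :=
  birel_multiplicative DB p /\ forall a, p (k a) = counit DA a *: (1 : C).

Definition coker : ualgType F := univ_alg kills.
Definition cproj : {linear B -> coker} := @ugen F B kills.

Lemma cproj_kills : kills cproj.
Proof.
split; first split=> a b.
- apply: univ_eq => C p hp; have [_ gM] := ulift_monoid_morphism hp.
  rewrite -(sw_appl _ _ (g := ulift hp)); last by mlin.
  rewrite ulift_gen -(birel_mul_l hp.1); apply: eq_sw => x y.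
  by rewrite gM !ulift_gen.
- apply: univ_eq => C p hp; have [_ gM] := ulift_monoid_morphism hp.
  rewrite -(sw_appl _ _ (g := ulift hp)); last by mlin.
  rewrite ulift_gen -(birel_mul_r hp.1); apply: eq_sw => x y.
  by rewrite gM !ulift_gen.
- move=> a; apply: univ_eq => C p hp; have [g1 _] := ulift_monoid_morphism hp.
  by rewrite ulift_gen hp.2 linearZ /= g1.
Qed.

Lemma coker_ind (P : coker -> Prop) :
  (forall b, P (cproj b)) -> P 1 ->
  (forall x y, P x -> P y -> P (x + y)) ->
  (forall x y, P x -> P y -> P (x * y)) ->
  (forall (c : F) x, P x -> P (c *: x)) -> forall x, P x.
Proof. exact: univ_ind. Qed.

Hypotheses (hA : is_weak_hopf DA) (hB : is_weak_hopf DB) (hk : is_hopf_hom DA DB k).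
Let comul_k := coalg_hom_comul (hopf_hom_coalg hk).
Let counit_k := coalg_hom_counit (hopf_hom_coalg hk).

Lemma counit_kills : kills (counit_alg DB).
Proof.
split; first exact: counit_birel.
by move=> a; rewrite -[LHS]/(counit DB (k a)) counit_k -[RHS]/(_ * 1) mulr1.
Qed.

Lemma comul_kills (C : ualgType F) (p : {linear B -> C}) :
  kills p -> kills (comul_map DB p).
Proof.
move=> [hp pk]; split; first exact: comul_birel.
move=> a; rewrite -[LHS]/(tmap p p (comul DB (k a))) comul_k.
rewrite {1}/tmap sw_tmap; last by mlin.
rewrite -(sw_counitl (whopf_coalgebra hA) a
  (g := fun u => counit DA u *: (1 : tensor C C))); last by mlin.
by apply: eq_sw => x y; rewrite !pk tpureZl tpureZr.
Qed.

Lemma antipode_kills (C : ualgType F) (p : {linear B -> C}) :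
  kills p -> kills (antipode_map DB p : {linear B -> opp_alg C}).
Proof.
move=> [hp pk]; split; first exact: antipode_birel.
move=> a; rewrite -[LHS]/(p (antipode DB (k a))) -(hopf_hom_antipode hk) pk.
by rewrite counit_antipode.
Qed.

(** As [k] preserves the unit and the coproduct, the legs of [Delta(1)] may be
    taken in the image of [k], where [p] is the counit. *)
Lemma kills_src (C : ualgType F) (p : {linear B -> C}) b :
  kills p -> p (src DB b) = counit DB b *: (1 : C).
Proof.
move=> [hp pk]; rewrite (src_appl _ _ (g := fun u => p u)); last by mlin.
rewrite -(hopf_hom_alg hk).1 comul_k sw_tmap; last by mlin.
transitivity (\sw_(x, y <- comul DA 1)
    (counit DA x *: (counit DB (b * k y) *: (1 : C)))).
  by apply: eq_sw => x y; rewrite pk !scalerA mulrC.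
rewrite (sw_counitl (whopf_coalgebra hA) 1
  (g := fun u => counit DB (b * k u) *: (1 : C))); last by mlin.
by rewrite (hopf_hom_alg hk).1 mulr1.
Qed.

Lemma kills_tgt (C : ualgType F) (p : {linear B -> C}) b :
  kills p -> p (tgt DB b) = counit DB b *: (1 : C).
Proof.
move=> [hp pk]; rewrite (tgt_appl _ _ (g := fun u => p u)); last by mlin.
rewrite -(hopf_hom_alg hk).1 comul_k sw_tmap; last by mlin.
transitivity (\sw_(x, y <- comul DA 1)
    (counit DA y *: (counit DB (k x * b) *: (1 : C)))).
  by apply: eq_sw => x y; rewrite pk !scalerA mulrC.
rewrite (sw_counitr (whopf_coalgebra hA) 1
  (g := fun u => counit DB (k u * b) *: (1 : C))); last by mlin.
by rewrite (hopf_hom_alg hk).1 mul1r.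
Qed.

(** What universality says about the three lifted maps: each is an (anti)morphism
    of algebras extending the corresponding map of [B].  Everything about the
    Hopf structure is deduced from these conditions alone. *)
Record induced_hopfData (DH : hopfData coker) : Prop := InducedHopfData {
  induced_comulM : monoid_morphism (comul DH);
  induced_counitM : monoid_morphism (counit DH);
  induced_antipode1 : antipode DH 1 = 1;
  induced_antipodeM : forall x y,
    antipode DH (x * y) = antipode DH y * antipode DH x;
  induced_comul : forall b, comul DH (cproj b) = tmap cproj cproj (comul DB b);
  induced_counit : forall b, counit DH (cproj b) = counit DB b;
  induced_antipode : forall b, antipode DH (cproj b) = cproj (antipode DB b)
}.

Lemma induced_hopfData_exists : exists DH, induced_hopfData DH.
Proof.
pose hd := comul_kills cproj_kills; pose he := counit_kills.
pose hs := antipode_kills cproj_kills.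
have eL : linear_for *%R (ulift he : coker -> F) by move=> c x y; rewrite linearP.
have sL : linear (ulift hs : coker -> coker) by move=> c x y; rewrite linearP.
pose e : {scalar coker} := HB.pack (ulift he : coker -> F)
  (GRing.isLinear.Build F coker F *%R (ulift he : coker -> F) eL).
pose s : {linear coker -> coker} := HB.pack (ulift hs : coker -> coker)
  (GRing.isLinear.Build F coker coker *:%R (ulift hs : coker -> coker) sL).
have [s1 sM] := ulift_monoid_morphism hs.
exists (HopfData (ulift hd) e s); split=> //.
- exact: ulift_monoid_morphism.
- exact: (ulift_monoid_morphism he).
- by move=> b; apply: (ulift_gen hd).
- by move=> b; apply: (ulift_gen he).
- by move=> b; apply: (ulift_gen hs).
Qed.

Section CokerHopf.
Variable DH : hopfData coker.
Hypothesis hDH : induced_hopfData DH.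
Let comulM := induced_comulM hDH.
Let counitM := induced_counitM hDH.
Let antipodeH1 := induced_antipode1 hDH.
Let antipodeHM := induced_antipodeM hDH.
Let comul_p := induced_comul hDH.
Let counit_p := induced_counit hDH.
Let antipode_p := induced_antipode hDH.

Let comp_mm (R S T : pzRingType) (g : S -> T) (f : R -> S) :
  monoid_morphism g -> monoid_morphism f -> monoid_morphism (g \o f).
Proof. by move=> [g1 gM] [f1 fM]; split=> [|x y] /=; rewrite ?f1 ?fM. Qed.

Lemma coker_coalgebra : is_coalgebra DH.
Proof.
split.
- apply: (univ_morphism_unique
    (g := fun a => tassoc (tmap (comul DH) id (comul DH a)))
    (g' := fun a => tmap id (comul DH) (comul DH a))).
  + by rewrite /tassoc /tmap; mlin.
  + by rewrite /tmap; mlin.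
  + apply: (comp_mm (tassoc_monoid_morphism _ _ _)).
    by apply: comp_mm comulM; apply: tmap_monoid_morphism => //; exact: linearP.
  + by apply: comp_mm comulM; apply: tmap_monoid_morphism => //; exact: linearP.
  + move=> b; rewrite -/(cproj b) comul_p.
    transitivity (\sw_(u, z <- comul DB b) \sw_(x, y <- comul DB u)
                    (cproj x \ot (cproj y \ot cproj z))).
      rewrite /tassoc sw_tmap; last by mlin.
      rewrite sw_tmap; last by mlin.
      by apply: eq_sw => u z; rewrite comul_p sw_tmap; last by mlin.
    rewrite (sw_coassoc (whopf_coalgebra hB) b
      (f := fun x y z => cproj x \ot (cproj y \ot cproj z))); last by mlin.
    rewrite [RHS]sw_tmap; last by mlin.
    apply: eq_sw => x w.
    by rewrite comul_p (sw_appl _ _ (g := fun u => cproj x \ot u)); last by mlin.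
- apply: (univ_morphism_unique
    (g := fun a => \sw_(x, y <- comul DH a) (counit DH x *: y)) (g' := id)).
  + mlin.
  + mlin.
  + split=> [|a b]; first by rewrite comulM.1 sw_pure ?counitM.1 ?scale1r //; mlin.
    rewrite comulM.2 sw_mul ?mul_sw; last by mlin.
    apply: eq_sw => x y; apply: eq_sw => x' y'.
    by rewrite counitM.2 -uscalerAl -uscalerAr scalerA.
  + by [].
  + move=> b; rewrite -/(cproj b) comul_p sw_tmap; last by mlin.
    rewrite -[RHS](sw_counitl (whopf_coalgebra hB) b (g := cproj)); last by mlin.
    by apply: eq_sw => x y; rewrite counit_p.
- apply: (univ_morphism_unique
    (g := fun a => \sw_(x, y <- comul DH a) (counit DH y *: x)) (g' := id)).
  + mlin.
  + mlin.
  + split=> [|a b]; first by rewrite comulM.1 sw_pure ?counitM.1 ?scale1r //; mlin.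
    rewrite comulM.2 sw_mul ?mul_sw; last by mlin.
    apply: eq_sw => x y; apply: eq_sw => x' y'.
    by rewrite counitM.2 -uscalerAl -uscalerAr scalerA.
  + by [].
  + move=> b; rewrite -/(cproj b) comul_p sw_tmap; last by mlin.
    rewrite -[RHS](sw_counitr (whopf_coalgebra hB) b (g := cproj)); last by mlin.
    by apply: eq_sw => x y; rewrite counit_p.
Qed.

(** The antipode axiom is not an identity of algebra morphisms, but the elements
    that satisfy it are closed under products: the sum over [Delta(a)] sits
    inside the one over [Delta(b)] and collapses first. *)
Lemma coker_antipode_l a :
  \sw_(x, y <- comul DH a) (antipode DH x * y) = counit DH a *: (1 : coker).
Proof.
have convL : linear (fun a => \sw_(x, y <- comul DH a) (antipode DH x * y)) by mlin.
elim/coker_ind: a => [b||a b ha hb|a b ha hb|c a ha].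
- rewrite comul_p counit_p sw_tmap; last by mlin.
  rewrite -(kills_src b cproj_kills) -(birel_antipode_l hB cproj_kills.1).
  by apply: eq_sw => x y; rewrite antipode_p.
- by rewrite comulM.1 sw_pure ?counitM.1 ?antipodeH1 ?mulr1 ?scale1r //; mlin.
- by rewrite [LHS](linear_mapD _ _ convL) ha hb linearD scalerDl.
- rewrite comulM.2 sw_mul; last by mlin.
  rewrite counitM.2 exchange_sw.
  transitivity (\sw_(x, y <- comul DH b) (counit DH a *: (antipode DH x * y))).
    apply: eq_sw => x y; rewrite uscalerAr -[y in RHS]mul1r uscalerAl -ha mulrA.
    rewrite -(sw_appl _ _ (g := fun u : coker => antipode DH x * u * y)); last by mlin.
    by apply: eq_sw => u v; rewrite antipodeHM !mulrA.
  by rewrite (sw_appl _ _ (g := fun u => _ *: u)) ?hb ?scalerA //; mlin.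
- have -> : counit DH (c *: a) = c * counit DH a by rewrite linearZ.
  by rewrite -scalerA -ha; apply: linear_mapZ convL.
Qed.

Lemma coker_antipode_r a :
  \sw_(x, y <- comul DH a) (x * antipode DH y) = counit DH a *: (1 : coker).
Proof.
have convL : linear (fun a => \sw_(x, y <- comul DH a) (x * antipode DH y)) by mlin.
elim/coker_ind: a => [b||a b ha hb|a b ha hb|c a ha].
- rewrite comul_p counit_p sw_tmap; last by mlin.
  rewrite -(kills_tgt b cproj_kills) -(birel_antipode_r hB cproj_kills.1).
  by apply: eq_sw => x y; rewrite antipode_p.
- by rewrite comulM.1 sw_pure ?counitM.1 ?antipodeH1 ?mulr1 ?scale1r //; mlin.
- by rewrite [LHS](linear_mapD _ _ convL) ha hb linearD scalerDl.
- rewrite comulM.2 sw_mul; last by mlin.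
  rewrite counitM.2 mulrC.
  transitivity (\sw_(x, y <- comul DH a) (counit DH b *: (x * antipode DH y))).
    apply: eq_sw => x y; rewrite uscalerAl -[x in RHS]mulr1 uscalerAr -hb.
    rewrite -(sw_appl _ _ (g := fun u : coker => x * u * antipode DH y)); last by mlin.
    by apply: eq_sw => u v; rewrite antipodeHM !mulrA.
  by rewrite (sw_appl _ _ (g := fun u => _ *: u)) ?ha ?scalerA //; mlin.
- have -> : counit DH (c *: a) = c * counit DH a by rewrite linearZ.
  by rewrite -scalerA -ha; apply: linear_mapZ convL.
Qed.

Lemma coker_is_hopf : is_hopf DH.
Proof.
split=> //; [exact: coker_coalgebra|exact: coker_antipode_l|exact: coker_antipode_r].
Qed.

Lemma cproj_is_hopf_map : is_hopf_map DB DH cproj.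
Proof. by split; [exact: cproj_kills.1 | split |]. Qed.

Lemma coker_lift_is_hopf_hom (H' : ualgType F) (DH' : hopfData H')
    (p : {linear B -> H'}) (g : {linear coker -> H'}) :
  is_hopf DH' -> is_hopf_map DB DH' p -> monoid_morphism g ->
  (forall b, g (cproj b) = p b) -> is_hopf_hom DH DH' g.
Proof.
move=> hH' hp gM gp; have gL : linear g by exact: linearP.
have hpc := hopf_map_coalg hp.
split=> //; first split.
- apply: (univ_morphism_unique (g := fun a => comul DH' (g a))
    (g' := fun a => tmap g g (comul DH a))).
  + mlin.
  + by rewrite /tmap; mlin.
  + exact: (comp_mm (hopf_comulM hH') gM).
  + by apply: comp_mm comulM; apply: tmap_monoid_morphism.
  + move=> b; rewrite -/(cproj b) gp comul_p (coalg_hom_comul hpc).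
    rewrite [RHS]sw_tmap; last by mlin.
    by apply: eq_sw => x y; rewrite !gp.
- apply: (univ_morphism_unique (C := scalar_alg F)
    (g := fun a => counit DH' (g a)) (g' := fun a => counit DH a)).
  + exact: linear_scalar.
  + by apply: linear_scalar; apply: linear_idfun.
  + exact: (comp_mm (hopf_counitM hH') gM).
  + exact: counitM.
  + by move=> b; rewrite -/(cproj b) gp counit_p (coalg_hom_counit hpc).
- have hw := hopf_is_weak_hopf hH'.
  apply: (univ_morphism_unique (C := opp_alg H')
    (g := fun a => g (antipode DH a)) (g' := fun a => antipode DH' (g a))).
  + by move=> c x y; rewrite !linearP.
  + by move=> c x y; rewrite !linearP.
  + by split=> [|x y]; rewrite ?antipodeH1 ?antipodeHM (gM.1, gM.2).
  + split=> [|x y]; first by rewrite gM.1 antipode1.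
    by rewrite gM.2 antipodeM.
  + by move=> b; rewrite -/(cproj b) gp antipode_p gp (hopf_map_antipode hp).
Qed.

End CokerHopf.
End Cokernel.

Theorem theorem3p4 (F : fieldType) (A B : ualgType F)
    (DA : hopfData A) (DB : hopfData B) (k : {linear A -> B})
    (hA : is_weak_hopf DA) (hB : is_weak_hopf DB) (hk : is_hopf_hom DA DB k) :
  exists (H : ualgType F) (p : {linear B -> H}),
    [/\ (* (a) *)
        birel_multiplicative DB p
        /\ (forall a : A, p (k a) = counit DA a *: (1 : H)),
        (* (b) *)
        forall (H' : ualgType F) (p' : {linear B -> H'}),
          birel_multiplicative DB p' ->
          (forall a : A, p' (k a) = counit DA a *: (1 : H')) ->
          exists g : {linear H -> H'},
            [/\ monoid_morphism g, forall b : B, g (p b) = p' b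
              & forall g' : {linear H -> H'},
                  monoid_morphism g' -> (forall b : B, g' (p b) = p' b) ->
                  g' =1 g]
      & exists DH : hopfData H,
          [/\ (* (c) *) is_hopf DH,
              (* (d) *) is_hopf_map DB DH p
            & (* (e) *)
              forall (H' : ualgType F) (DH' : hopfData H') (p' : {linear B -> H'}),
                is_hopf DH' -> is_hopf_map DB DH' p' ->
                (forall a : A, p' (k a) = counit DA a *: (1 : H')) ->
                exists g : {linear H -> H'},
                  [/\ is_hopf_hom DH DH' g, forall b : B, g (p b) = p' b
                    & forall g' : {linear H -> H'},
                        is_hopf_hom DH DH' g' ->
                        (forall b : B, g' (p b) = p' b) ->
                        g' =1 g]]].
Proof.
have unique (H' : ualgType F) (p' : {linear B -> H'})
    (g g' : {linear coker DA DB k -> H'}) :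
    monoid_morphism g -> (forall b, g (cproj DA DB k b) = p' b) ->
    monoid_morphism g' -> (forall b, g' (cproj DA DB k b) = p' b) -> g' =1 g.
  move=> gM gp g'M g'p; apply: univ_morphism_unique => // [||b]; try exact: linearP.
  by rewrite -/(cproj DA DB k b) gp g'p.
exists (coker DA DB k), (cproj DA DB k).
split; first exact: cproj_kills.
- move=> H' p' hp' p'k; pose hk' : kills DA DB k p' := conj hp' p'k.
  have gM := ulift_monoid_morphism hk'; have gp := ulift_gen hk'.
  by exists (ulift hk'); split=> // g'; exact: unique.
- have [DH hDH] := induced_hopfData_exists hA hB hk.
  exists DH; split; [exact: coker_is_hopf | exact: cproj_is_hopf_map |].
  move=> H' DH' p' hH' hp' p'k.
  pose hk' : kills DA DB k p' := conj (hopf_map_birel hp') p'k.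
  have gM := ulift_monoid_morphism hk'; have gp := ulift_gen hk'.
  exists (ulift hk'); split=> //.
    exact: (coker_lift_is_hopf_hom hDH hH' hp').
  by move=> g' [g'M _ _]; exact: unique.
Qed.
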